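(* The category $\mathbf{cbasic}$ of compact basic extensions is dually equivalent to the category $\mathbf{KHaus}$ of compact Hausdorff spaces and continuous maps.
   Context: An $\ell$-ring is a ring $A$ with $1$ and a partial order $\le$ making $A$ a lattice, such that $a\le b$ implies $a+c\le b+c$, and $0\le a,b$ implies $0\le ab$. It is bounded if for each $a$ there is $n\in\mathbb N$ with $a\le n\cdot 1$; archimedean if $na\le b$ for all $n\in\mathbb N$ implies $a\le 0$; an $\ell$-algebra if it is an $\mathbb R$-algebra and $0\le a\in A$, $0\le r\in\mathbb R$ imply $0\le ra$. Let $\mathbf{bal}$ be the category of bounded archimedean $\ell$-algebras and unital $\ell$-algebra homomorphisms. Real numbers $r$ are identified with $r\cdot 1$. $A\in\mathbf{bal}$ is uniformly complete if it is complete in the norm $\|a\|=\inf\{r\in\mathbb R: |a|\le r\}$, where $|a|=a\vee(-a)$; $\mathbf{ubal}$ is the full subcategory of $\mathbf{bal}$ of uniformly complete objects. $B\in\mathbf{bal}$ is Dedekind complete if each (nonempty) subset bounded above has a least upper bound. A basic algebra is a Dedekind complete $B\in\mathbf{bal}$ whose boolean algebra of idempotents is atomic. A unital $\ell$-algebra homomorphism between Dedekind complete algebras is normal if it preserves all existing joins (hence all existing meets). A basic extension is a monomorphism $\alpha:A\to B$ in $\mathbf{bal}$, with $B$ a basic algebra, such that each element of $B$ is a join of meets of elements of $\alpha[A]$. The category $\mathbf{basic}$ has basic extensions as objects; a morphism from $\alpha:A\to B$ to $\alpha':A'\to B'$ is a pair $(\rho,\sigma)$ of morphisms $\rho:A\to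 A'$, $\sigma:B\to B'$ in $\mathbf{bal}$ with $\sigma$ normal and $\sigma\circ\alpha=\alpha'\circ\rho$; composition is componentwise. A basic extension $\alpha:A\to B$ satisfies (C) if for all $S,T\subseteq A$ and $\varepsilon>0$: if $\bigwedge\alpha[S]+\varepsilon\le\bigvee\alpha[T]$ (the meet and join being presupposed to exist in $B$), then there are finite subsets $S'\subseteq S$ and $T'\subseteq T$ with $\bigwedge S'\le\bigvee T'$. A basic extension $\alpha:A\to B$ is compact if $A\in\mathbf{ubal}$ and $\alpha$ satisfies (C). $\mathbf{cbasic}$ is the full subcategory of $\mathbf{basic}$ consisting of compact basic extensions. *)

(* Defs.v *)
From HB Require Import structures.
From mathcomp Require Import all_boot all_order all_algebra.
From mathcomp Require Import all_classical all_reals all_analysis.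

Set Implicit Arguments.
Unset Strict Implicit.
Unset Printing Implicit Defensive.

Import Order.TTheory GRing.Theory Num.Theory.

Local Open Scope classical_set_scope.
Local Open Scope ring_scope.

(** * Categories *)

Record category := Category {
  obj :> Type;
  hom : obj -> obj -> Type;
  idm : forall x, hom x x;
  comp : forall x y z, hom y z -> hom x y -> hom x z;
  comp1f : forall x y (f : hom x y), comp (idm y) f = f;
  compf1 : forall x y (f : hom x y), comp f (idm x) = f;
  compA : forall x y z t (h : hom z t) (g : hom y z) (f : hom x y),
    comp h (comp g f) = comp (comp h g) f }.

Arguments hom {c} x y.
Arguments idm {c} x.
Arguments comp {c x y z} g f.

Definition op_category (C : category) : category :=
  @Category C (fun x y => @hom C y x) (fun x => idm x)
    (fun x y z g f => comp f g)
    (fun x y f => compf1 f) (fun x y f => comp1f f)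
    (fun x y z t h g f => esym (compA f g h)).

Definition full_subcategory (C : category) (P : C -> Prop) : category :=
  @Category {x : C | P x} (fun x y => hom (sval x) (sval y))
    (fun x => idm (sval x)) (fun x y z g f => comp g f)
    (fun x y f => comp1f f) (fun x y f => compf1 f)
    (fun x y z t h g f => compA h g f).

Definition monic (C : category) (x y : C) (f : hom x y) : Prop :=
  forall (z : C) (g h : hom z x), comp f g = comp f h -> g = h.

Definition is_iso (C : category) (x y : C) (f : hom x y) : Prop :=
  exists g : hom y x, comp g f = idm x /\ comp f g = idm y.

Record functor (C D : category) := Functor {
  fobj :> C -> D;
  fmap : forall x y, hom x y -> hom (fobj x) (fobj y);
  fmap1 : forall x, fmap (idm x) = idm (fobj x);
  fmapM : forall x y z (g : hom y z) (f : hom x y),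
    fmap (comp g f) = comp (fmap g) (fmap f) }.

Arguments fmap {C D} f {x y} : rename.

Definition functor_id (C : category) : functor C C :=
  @Functor C C id (fun x y f => f) (fun=> erefl) (fun x y z g f => erefl).

Lemma functor_comp1 (C D E : category) (G : functor D E) (F : functor C D) x :
  fmap G (fmap F (idm x)) = idm (G (F x)).
Proof. by rewrite !fmap1. Qed.

Lemma functor_compM (C D E : category) (G : functor D E) (F : functor C D)
    x y z (g : hom y z) (f : hom x y) :
  fmap G (fmap F (comp g f)) = comp (fmap G (fmap F g)) (fmap G (fmap F f)).
Proof. by rewrite !fmapM. Qed.

Definition functor_comp (C D E : category) (G : functor D E) (F : functor C D) :
    functor C E :=
  @Functor C E (fun x => G (F x)) (fun x y f => fmap G (fmap F f))
    (functor_comp1 G F) (functor_compM G F).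

Definition naturally_isomorphic (C D : category) (F G : functor C D) : Prop :=
  exists eta : forall x, hom (F x) (G x),
    (forall x, is_iso (eta x)) /\
    (forall x y (f : hom x y), comp (eta y) (fmap F f) = comp (fmap G f) (eta x)).

Definition equivalent (C D : category) : Prop :=
  exists (F : functor C D) (G : functor D C),
    naturally_isomorphic (functor_comp G F) (functor_id C) /\
    naturally_isomorphic (functor_comp F G) (functor_id D).

Definition dually_equivalent (C D : category) : Prop :=
  equivalent C (op_category D).

(** * Compact Hausdorff spaces *)

Lemma continuous_comp1f (X Y : topologicalType) (f : continuousType X Y) :
  (idfun \o f : continuousType X Y) = f.
Proof. exact/continuousEP. Qed.

Lemma continuous_compf1 (X Y : topologicalType) (f : continuousType X Y) :
  (f \o idfun : continuousType X Y) = f.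
Proof. exact/continuousEP. Qed.

Lemma continuous_compA (X Y Z T : topologicalType) (h : continuousType Z T)
    (g : continuousType Y Z) (f : continuousType X Y) :
  (h \o (g \o f : continuousType X Z) : continuousType X T) =
  ((h \o g : continuousType Y T) \o f : continuousType X T).
Proof. exact/continuousEP. Qed.

Definition Top : category :=
  @Category topologicalType (fun X Y => continuousType X Y)
    (fun X => idfun : continuousType X X)
    (fun X Y Z g f => g \o f : continuousType X Z)
    continuous_comp1f continuous_compf1 continuous_compA.

Definition KHaus : category :=
  full_subcategory (C := Top)
    (fun X : topologicalType => compact [set: X] /\ hausdorff_space X).

(** * l-rings and l-algebras *)

(* Rings may be zero (the zero algebra is dual to the empty space), so the
   library's [algType], which assumes 1 != 0, is not usable. The structures are
   plain records since Hierarchy Builder accepts no new join of a ring structure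
   with [Order.Lattice] or [GRing.Lmodule]. *)

Record lringData := LRingData {
  lring_lattice : latticeType ring_display;
  lring_pzRing : GRing.isPzRing lring_lattice }.

Definition lring_sort (A : lringData) : Type := lring_lattice A.
Coercion lring_sort : lringData >-> Sortclass.

HB.instance Definition _ (A : lringData) :=
  Order.Lattice.copy (lring_sort A) (lring_lattice A).
HB.instance Definition _ (A : lringData) :=
  (lring_pzRing A : GRing.isPzRing (lring_sort A)).

Record lringType := LRing {
  lring_data :> lringData;
  lring_leD2r : forall a b c : lring_data, a <= b -> a + c <= b + c;
  lring_mulr_ge0 : forall a b : lring_data, 0 <= a -> 0 <= b -> 0 <= a * b }.

Record lalgebraData (R : realType) := LAlgebraData {
  lalgebra_lring :> lringType;
  lalgebra_lmodule : GRing.Zmodule_isLmodule R lalgebra_lring }.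

HB.instance Definition _ (R : realType) (A : lalgebraData R) :=
  (lalgebra_lmodule A : GRing.Zmodule_isLmodule R (lring_sort A)).

Record lalgebraType (R : realType) := LAlgebra {
  lalgebra_data :> lalgebraData R;
  lalgebra_scalerAl : forall (r : R) (a b : lalgebra_data),
    r *: (a * b) = (r *: a) * b;
  lalgebra_scalerAr : forall (r : R) (a b : lalgebra_data),
    r *: (a * b) = a * (r *: b);
  lalgebra_scaler_ge0 : forall (r : R) (a : lalgebra_data),
    0 <= r -> 0 <= a -> 0 <= r *: a }.

Definition lring_bounded (A : lringType) : Prop :=
  forall a : A, exists n : nat, a <= n%:R.

Definition lring_archimedean (A : lringType) : Prop :=
  forall a b : A, (forall n : nat, a *+ n <= b) -> a <= 0.

Record balType (R : realType) := Bal {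
  bal_lalgebra :> lalgebraType R;
  bal_bounded : lring_bounded bal_lalgebra;
  bal_archimedean : lring_archimedean bal_lalgebra }.

Record balHom (R : realType) (A B : balType R) := BalHom {
  balHom_rmorphism :> {rmorphism A -> B};
  balHom_scalable : scalable balHom_rmorphism;
  balHom_meet : Order.meet_morphism balHom_rmorphism;
  balHom_join : Order.join_morphism balHom_rmorphism }.

Lemma balHom_ext (R : realType) (A B : balType R) (f g : balHom A B) :
  f =1 g -> f = g.
Proof.
case: f g => [f fZ fI fU] [g gZ gI gU] /= /funext efg.
have {}efg : f = g.
  case: f g efg {fZ fI fU gZ gI gU} => f cf [g cg] /= efg.
  move: cg; rewrite -{g}efg => cg; congr GRing.RMorphism.Pack.
  case: cf cg => -[f0D] [fM] [[g0D] [gM]].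
  by rewrite (Prop_irrelevance f0D g0D) (Prop_irrelevance fM gM).
rewrite -{g}efg in gZ gI gU *.
rewrite (Prop_irrelevance fZ gZ) (Prop_irrelevance fI gI).
by rewrite (Prop_irrelevance fU gU).
Qed.

Section BalCategory.
Variable R : realType.

Definition bal_id (A : balType R) : balHom A A :=
  @BalHom R A A (idfun : {rmorphism A -> A})
    (fun _ _ => erefl) (fun _ _ => erefl) (fun _ _ => erefl).

Section Composition.
Variables (A B C : balType R) (g : balHom B C) (f : balHom A B).

Let gf : {rmorphism A -> C} := g \o f.

Lemma bal_comp_scalable : scalable gf.
Proof. by move=> r a; rewrite /= !balHom_scalable. Qed.

Lemma bal_comp_meet : Order.meet_morphism gf.
Proof. by move=> a b; rewrite /= !balHom_meet. Qed.

Lemma bal_comp_join : Order.join_morphism gf.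
Proof. by move=> a b; rewrite /= !balHom_join. Qed.

Definition bal_comp : balHom A C :=
  BalHom bal_comp_scalable bal_comp_meet bal_comp_join.

End Composition.

Lemma bal_comp1f (A B : balType R) (f : balHom A B) : bal_comp (bal_id B) f = f.
Proof. exact: balHom_ext. Qed.

Lemma bal_compf1 (A B : balType R) (f : balHom A B) : bal_comp f (bal_id A) = f.
Proof. exact: balHom_ext. Qed.

Lemma bal_compA (A B C D : balType R) (h : balHom C D) (g : balHom B C)
  (f : balHom A B) : bal_comp h (bal_comp g f) = bal_comp (bal_comp h g) f.
Proof. exact: balHom_ext. Qed.

Definition bal : category :=
  @Category (balType R) (fun A B => balHom A B) bal_id bal_comp
    bal_comp1f bal_compf1 bal_compA.

(* [inf] takes the value 0 on sets without infimum, which happens only in the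
   zero algebra. *)
Definition bal_norm (A : balType R) (a : A) : R :=
  inf [set r : R | Order.join a (- a) <= r *: (1 : A)].

Definition uniformly_complete (A : balType R) : Prop :=
  forall u : nat -> A,
    (forall e : R, 0 < e -> exists N : nat, forall m n : nat,
       (N <= m)%N -> (N <= n)%N -> bal_norm (u m - u n) < e) ->
    exists l : A, forall e : R, 0 < e -> exists N : nat, forall n : nat,
       (N <= n)%N -> bal_norm (u n - l) < e.

Definition dedekind_complete (B : balType R) : Prop :=
  forall S : set B, S !=set0 -> has_ubound S -> supremums S !=set0.

Definition is_idempotent (B : balType R) (e : B) : Prop := e * e = e.

(* The order of the boolean algebra of idempotents, whose meet is the product. *)
Definition idempotent_le (B : balType R) (e f : B) : Prop := e * f = e.

Definition is_idempotent_atom (B : balType R) (e : B) : Prop :=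
  [/\ is_idempotent e, e <> 0 &
      forall f : B, is_idempotent f -> idempotent_le f e -> f = 0 \/ f = e].

Definition idempotents_atomic (B : balType R) : Prop :=
  forall f : B, is_idempotent f -> f <> 0 ->
    exists2 e : B, is_idempotent_atom e & idempotent_le e f.

Definition basic_algebra (B : balType R) : Prop :=
  dedekind_complete B /\ idempotents_atomic B.

Definition normal (B B' : balType R) (sigma : balHom B B') : Prop :=
  forall (S : set B) (b : B), supremums S b -> supremums (sigma @` S) (sigma b).

(** * Basic extensions *)

Definition join_of_meets (A B : balType R) (alpha : balHom A B) (b : B) : Prop :=
  exists2 D : set B,
    (forall d, D d -> exists S : set A, infimums (alpha @` S) d) &
    supremums D b.

Record basic_extension := BasicExtension {
  ext_dom : balType R;
  ext_cod : balType R;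
  ext_map :> balHom ext_dom ext_cod;
  ext_monic : monic (C := bal) ext_map;
  ext_basic : basic_algebra ext_cod;
  ext_dense : forall b : ext_cod, join_of_meets ext_map b }.

Record basic_hom (alpha alpha' : basic_extension) := BasicHom {
  hom_dom : balHom (ext_dom alpha) (ext_dom alpha');
  hom_cod : balHom (ext_cod alpha) (ext_cod alpha');
  hom_normal : normal hom_cod;
  hom_commute : bal_comp hom_cod alpha = bal_comp alpha' hom_dom }.

Lemma basic_hom_ext (alpha alpha' : basic_extension)
    (f g : basic_hom alpha alpha') :
  hom_dom f = hom_dom g -> hom_cod f = hom_cod g -> f = g.
Proof.
case: f g => [rho sigma n c] [rho' sigma' n' c'] /= er es.
rewrite -{rho'}er -{sigma'}es in n' c' *.
by rewrite (Prop_irrelevance n n') (Prop_irrelevance c c').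
Qed.

Lemma normal_id (B : balType R) : normal (bal_id B).
Proof. by move=> S b; rewrite image_id. Qed.

Lemma normal_comp (A B C : balType R) (g : balHom B C) (f : balHom A B) :
  normal g -> normal f -> normal (bal_comp g f).
Proof. by move=> gN fN S b /fN/gN; rewrite image_comp. Qed.

Lemma basic_id_commute (alpha : basic_extension) :
  bal_comp (bal_id (ext_cod alpha)) alpha =
  bal_comp alpha (bal_id (ext_dom alpha)).
Proof. by rewrite bal_comp1f bal_compf1. Qed.

Definition basic_id (alpha : basic_extension) : basic_hom alpha alpha :=
  BasicHom (@normal_id _) (basic_id_commute alpha).

Section BasicComposition.
Variables (alpha beta gamma : basic_extension).
Variables (g : basic_hom beta gamma) (f : basic_hom alpha beta).

Lemma basic_comp_commute :
  bal_comp (bal_comp (hom_cod g) (hom_cod f)) alpha =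
  bal_comp gamma (bal_comp (hom_dom g) (hom_dom f)).
Proof. by rewrite -bal_compA hom_commute bal_compA hom_commute bal_compA. Qed.

Definition basic_comp : basic_hom alpha gamma :=
  BasicHom (normal_comp (@hom_normal _ _ g) (@hom_normal _ _ f))
    basic_comp_commute.

End BasicComposition.

Lemma basic_comp1f (alpha beta : basic_extension) (f : basic_hom alpha beta) :
  basic_comp (basic_id beta) f = f.
Proof. by apply: basic_hom_ext; rewrite /= bal_comp1f. Qed.

Lemma basic_compf1 (alpha beta : basic_extension) (f : basic_hom alpha beta) :
  basic_comp f (basic_id alpha) = f.
Proof. by apply: basic_hom_ext; rewrite /= bal_compf1. Qed.

Lemma basic_compA (alpha beta gamma delta : basic_extension)
    (h : basic_hom gamma delta) (g : basic_hom beta gamma)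
    (f : basic_hom alpha beta) :
  basic_comp h (basic_comp g f) = basic_comp (basic_comp h g) f.
Proof. by apply: basic_hom_ext; rewrite /= bal_compA. Qed.

Definition basic : category :=
  @Category basic_extension basic_hom basic_id basic_comp
    basic_comp1f basic_compf1 basic_compA.

(* Infinite and finite meets and joins are referred to relationally, through
   [infimums] and [supremums], so that their existence is part of the
   statement; in particular S' and T' are nonempty unless A = 0. *)
Definition conditionC (A B : balType R) (alpha : balHom A B) : Prop :=
  forall (S T : set A) (e : R) (i j : B), 0 < e ->
    infimums (alpha @` S) i -> supremums (alpha @` T) j ->
    i + e *: (1 : B) <= j ->
    exists S' T' : set A,
      [/\ S' `<=` S, finite_set S', T' `<=` T, finite_set T' &
          exists s t : A, [/\ infimums S' s, supremums T' t & s <= t]].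

Definition compact_extension (alpha : basic_extension) : Prop :=
  uniformly_complete (ext_dom alpha) /\ conditionC alpha.

Definition cbasic : category :=
  full_subcategory (C := basic) compact_extension.

End BalCategory.

(* Main.v *)
(* The functor X |-> (C(X) -> l^oo(X)) is fully faithful and essentially
   surjective from KHaus^op to cbasic. A normal homomorphism l^oo(X) -> l^oo(Y)
   is composition with a map Y -> X, which is continuous as soon as it pulls
   continuous functions back to continuous functions. Conversely, in a basic
   algebra B an atom e of the idempotents satisfies e b = v_e(b) e for a unique
   real v_e(b), and b |-> (v_e(b))_e is an isomorphism of B onto the bounded
   functions on the set X of atoms. Given a compact basic extension A -> B,
   topologize X by the sets {v(a) > 0} with a in A. Density of A makes X
   Hausdorff, and (C) makes X compact. A continuous f on X is both the meet of the
   elements of A above it and the join of those below it, so (C), applied to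
   inf f + eps <= sup (f + eps), gives s in A with f <= s <= f + eps; by uniform
   completeness f lies in A. *)

From HB Require Import structures.
From mathcomp Require Import all_boot all_order all_algebra.
From mathcomp Require Import all_classical all_reals all_analysis.
From mathcomp Require Import ring lra.
Require Import Defs.

Set Implicit Arguments.
Unset Strict Implicit.
Unset Printing Implicit Defensive.

Import Order.TTheory GRing.Theory Num.Theory.
Import numFieldNormedType.Exports.

Local Open Scope classical_set_scope.
Local Open Scope ring_scope.

Local Notation join := Order.join.
Local Notation meet := Order.meet.

(** * Lattice-ordered rings and bounded archimedean l-algebras *)

(** The value of an atom e at b rests on completeness twice. In B it provides, for each positive b,
    a largest component of 1 disjoint from b; hence e annihilates one of any two disjoint positive
    elements, and e b is comparable with every r e. In R it provides the supremum of the cut {r | r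
    e <= e b}. Multiplication is not assumed commutative and is tied to the order by boundedness:
    disjoint positive elements have product 0. This turns idempotents into complemented elements of
    the interval [0, 1], so that atoms can be handled by lattice arguments. The finite meets and
    joins in (C) are relational, and an empty one would be a greatest or least element of A; each
    application of (C) therefore treats empty subfamilies apart. *)

Section LringTheory.
Variable A : lringType.
Implicit Types a b c d x : A.

Lemma lr_leD2rE a b c : (a + c <= b + c) = (a <= b).
Proof.
apply/idP/idP => [h|]; last exact: lring_leD2r.
by have := lring_leD2r (- c) h; rewrite !addrK.
Qed.

Lemma lr_leD2lE a b c : (c + a <= c + b) = (a <= b).
Proof. by rewrite ![c + _]addrC lr_leD2rE. Qed.

Lemma lr_leBlE a b c : (a - c <= b) = (a <= b + c).
Proof. by rewrite -[LHS](lr_leD2rE _ _ c) subrK. Qed.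

Lemma lr_leBrE a b c : (a <= b - c) = (a + c <= b).
Proof. by rewrite -[LHS](lr_leD2rE _ _ c) subrK. Qed.

Lemma lr_subge0 a b : (0 <= b - a) = (a <= b).
Proof. by rewrite lr_leBrE add0r. Qed.

Lemma lr_leN2E a b : (- a <= - b) = (b <= a).
Proof. by rewrite -[LHS](lr_leD2rE _ _ (a + b)) addKr [a + b]addrC addKr. Qed.

Lemma lr_leNl a b : (- a <= b) = (- b <= a).
Proof. by rewrite -[LHS]lr_leN2E opprK. Qed.

Lemma lr_leD a b c d : a <= b -> c <= d -> a + c <= b + d.
Proof.
by move=> ab cd; apply: (le_trans (lring_leD2r c ab)); rewrite lr_leD2lE.
Qed.

Lemma lr_addr_ge0 a b : 0 <= a -> 0 <= b -> 0 <= a + b.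
Proof. by move=> a0 b0; rewrite -[0]addr0; exact: lr_leD. Qed.

Lemma lr_mulrn_ge0 a n : 0 <= a -> 0 <= a *+ n.
Proof.
by move=> a0; elim: n => [|n ih]; rewrite ?mulr0n // mulrS; exact: lr_addr_ge0.
Qed.

Lemma lr_joinDr a b c : join a b + c = join (a + c) (b + c).
Proof.
apply/le_anti/andP; split.
  by rewrite -lr_leBrE leUx !lr_leBrE leUl leUr.
by rewrite leUx !lr_leD2rE leUl leUr.
Qed.

Lemma lr_meetDr a b c : meet a b + c = meet (a + c) (b + c).
Proof.
apply/le_anti/andP; split.
  by rewrite lexI !lr_leD2rE leIl leIr.
by rewrite -lr_leBlE lexI !lr_leBlE leIl leIr.
Qed.

Lemma lr_oppU a b : - join a b = meet (- a) (- b).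
Proof.
apply/le_anti/andP; split.
  by rewrite lexI !lr_leN2E leUl leUr.
rewrite -lr_leN2E opprK leUx -[a <= _]lr_leN2E -[b <= _]lr_leN2E.
by rewrite opprK leIl leIr.
Qed.

Lemma lr_oppI a b : - meet a b = join (- a) (- b).
Proof. by rewrite -[in LHS](opprK a) -[in LHS](opprK b) -lr_oppU opprK. Qed.

(** Translating the join by [- (a + b)] gives the join of [- b] and [- a], which is minus the
    meet. *)
Lemma lr_joinDmeet a b : join a b + meet a b = a + b.
Proof.
have h : join a b - (a + b) = - meet a b.
  rewrite lr_joinDr lr_oppI opprD addrA subrr add0r addrCA subrr addr0.
  exact: joinC.
by rewrite -[join a b](subrK (a + b)) h addrAC addNr add0r.
Qed.

(** Expanded, the right-hand side is a meet of sums each of which dominates a or equals b + c. *)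
Lemma lr_meetD_le a b c : 0 <= a -> 0 <= b -> 0 <= c ->
  meet a (b + c) <= meet a b + meet a c.
Proof.
move=> a0 b0 c0; rewrite lr_meetDr lexI; apply/andP; split.
  by apply: le_trans (leIl _ _) _; rewrite -{1}[a]addr0 lr_leD2lE lexI a0.
rewrite [b + meet _ _]addrC lr_meetDr lexI [c + b]addrC leIr andbT.
by apply: le_trans (leIl _ _) _; rewrite -{1}[a]addr0 lr_leD2lE.
Qed.

Lemma lr_meetMn0 a b n : 0 <= a -> 0 <= b -> meet a b = 0 -> meet a (b *+ n) = 0.
Proof.
move=> a0 b0 ab; apply/le_anti/andP; split; last by rewrite lexI a0 lr_mulrn_ge0.
elim: n => [|n ih]; first by rewrite mulr0n leIr.
rewrite mulrS; apply: le_trans (lr_meetD_le a0 b0 (lr_mulrn_ge0 n b0)) _.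
by rewrite ab add0r.
Qed.

Definition pos_part a := join a 0.

Lemma pos_part_ge0 a : 0 <= pos_part a.
Proof. exact: leUr. Qed.

Lemma pos_part_ge a : a <= pos_part a.
Proof. exact: leUl. Qed.

Lemma pos_partN a : pos_part (- a) = pos_part a - a.
Proof. by rewrite /pos_part lr_joinDr subrr add0r joinC. Qed.

Lemma pos_part_decomp a : a = pos_part a - pos_part (- a).
Proof. by rewrite pos_partN subKr. Qed.

Lemma pos_part_disj a : meet (pos_part a) (pos_part (- a)) = 0.
Proof.
rewrite pos_partN -{1}[pos_part a]add0r addrC [_ - a]addrC addrC -lr_meetDr.
by rewrite -oppr0 -lr_oppU oppr0 joinC addNr.
Qed.

Lemma lr_joinE a b : join a b = a + pos_part (b - a).
Proof. by rewrite addrC lr_joinDr subrK add0r joinC. Qed.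

Lemma lr_ler_pMl a b c : 0 <= c -> a <= b -> c * a <= c * b.
Proof.
move=> c0; rewrite -lr_subge0 => ab.
by rewrite -lr_subge0 -mulrBr; exact: lring_mulr_ge0.
Qed.

Lemma lr_ler_pMr a b c : 0 <= c -> a <= b -> a * c <= b * c.
Proof.
move=> c0; rewrite -lr_subge0 => ab.
by rewrite -lr_subge0 -mulrBl; exact: lring_mulr_ge0.
Qed.

End LringTheory.

Section BalTheory.
Variables (R : realType) (A : balType R).
Implicit Types (a b c d x e u : A) (r s t : R).

Lemma bal_scaler_ge0 r a : 0 <= r -> 0 <= a -> 0 <= r *: a.
Proof. exact: lalgebra_scaler_ge0. Qed.

Lemma bal_scaleAl r a b : r *: (a * b) = (r *: a) * b.
Proof. exact: lalgebra_scalerAl. Qed.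

Lemma bal_scaleAr r a b : r *: (a * b) = a * (r *: b).
Proof. exact: lalgebra_scalerAr. Qed.

Lemma bal_ler_pZl r a b : 0 <= r -> a <= b -> r *: a <= r *: b.
Proof.
move=> r0; rewrite -lr_subge0 => ab.
by rewrite -lr_subge0 -scalerBr; exact: bal_scaler_ge0.
Qed.

Lemma bal_ler_wZr r s a : 0 <= a -> r <= s -> r *: a <= s *: a.
Proof.
move=> a0 rs.
by rewrite -lr_subge0 -scalerBl; apply: bal_scaler_ge0; rewrite ?subr_ge0.
Qed.

Lemma bal_ler_pZlE r a b : 0 < r -> (r *: a <= r *: b) = (a <= b).
Proof.
move=> r0; apply/idP/idP => [h|]; last exact/bal_ler_pZl/ltW.
rewrite -[a]scale1r -[b]scale1r -(mulVf (lt0r_neq0 r0)) -!scalerA.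
by apply: bal_ler_pZl h; rewrite invr_ge0 ltW.
Qed.

Lemma bal_scale_half a : 2^-1 *: (a + a) = a.
Proof.
by rewrite -mulr2n -[a *+ 2]scaler_nat scalerA mulVf ?scale1r ?pnatr_eq0.
Qed.

(** Twice |a| dominates a + (- a) = 0, and the real scalar 1/2 removes the factor. *)
Lemma bal_abs_ge0 a : 0 <= join a (- a).
Proof.
rewrite -[join _ _]bal_scale_half; apply: bal_scaler_ge0; rewrite ?invr_ge0 //.
by rewrite -(subrr a); apply: lr_leD; rewrite ?leUl ?leUr.
Qed.

(** Not among the axioms. Boundedness gives |1| <= n, so n is positive in A and can be divided by
    the real number n; when n = 0 the bound itself reads - 1 <= 0. *)
Lemma bal_ler01 : 0 <= 1 :> A.
Proof.
have [n hn] := bal_bounded (join (1 : A) (- 1)).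
have h0 : 0 <= n%:R :> A := le_trans (bal_abs_ge0 1) hn.
case: n hn h0 => [|n] hn h0.
  have /andP[a1 b1] : (1 <= 0 :> A) && (- 1 <= 0 :> A) by rewrite -leUx.
  by rewrite -lr_leN2E oppr0.
rewrite -[1]scale1r -(@mulVf _ n.+1%:R) ?pnatr_eq0 // -scalerA scaler_nat.
by apply: bal_scaler_ge0 => //; rewrite invr_ge0.
Qed.

Lemma bal_bound a : exists r, [/\ 0 < r, a <= r *: (1 : A) & - a <= r *: (1 : A)].
Proof.
have [n hn] := bal_bounded (join a (- a)).
move: hn; rewrite leUx => /andP[h1 h2].
have nS : (n%:R : A) <= n.+1%:R *: (1 : A).
  by rewrite scaler_nat [n.+1%:R]mulrS -{1}[n%:R]add0r lr_leD2rE bal_ler01.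
exists n.+1%:R; split; first by rewrite ltr0n.
- exact: le_trans h1 nS.
- exact: le_trans h2 nS.
Qed.

Lemma bal_arch_eps a b : 0 <= b -> (forall r, 0 < r -> a <= r *: b) -> a <= 0.
Proof.
move=> b0 h; apply: (@bal_archimedean _ _ a b) => -[|n]; first by rewrite mulr0n.
rewrite -scaler_nat -(@bal_ler_pZlE n.+1%:R^-1) ?invr_gt0 ?ltr0n //.
by rewrite scalerA mulVf ?pnatr_eq0 // scale1r; apply: h; rewrite invr_gt0 ltr0n.
Qed.

Lemma bal_scale_le a r s : 0 <= a -> a <> 0 -> (r *: a <= s *: a) = (r <= s).
Proof.
move=> a0 /eqP an0; apply/idP/idP => [|rs]; last exact: bal_ler_wZr.
rewrite -lr_subge0 -scalerBl; apply: contraTT; rewrite -ltNge => sr.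
apply: contra an0 => h.
have : (r - s)^-1 *: ((r - s) *: a) <= 0.
  rewrite -lr_leN2E oppr0 -scalerN -scaleNr opprB; apply: bal_scaler_ge0 => //.
  by rewrite invr_ge0 subr_ge0 ltW.
rewrite scalerA mulVf ?scale1r; last by rewrite subr_eq0 gt_eqF.
by move=> h1; apply/eqP/le_anti; rewrite h1 a0.
Qed.

(** The scalar r is replaced by a natural number above it. Only an inequality holds, since r may be
    negative. *)
Lemma bal_disj_scale r a b : 0 <= a -> 0 <= b -> meet a b = 0 ->
  meet a (r *: b) <= 0.
Proof.
move=> a0 b0 ab; have [n rn] : exists n, r <= n%:R.
  exists (Num.truncn `|r|).+1; apply: le_trans (ler_norm r) _.
  by rewrite ltW // truncnS_gt.
rewrite -(lr_meetMn0 n a0 b0 ab) lexI leIl /=; apply: le_trans (leIr _ _) _.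
by rewrite -scaler_nat; apply: bal_ler_wZr.
Qed.

(** If a <= r and b <= s, then a b lies below both r b and s a, and these are again disjoint. *)
Lemma bal_disj_mul a b : 0 <= a -> 0 <= b -> meet a b = 0 -> a * b = 0.
Proof.
move=> a0 b0 ab; apply/le_anti/andP; split; last exact: lring_mulr_ge0.
have [r [r0 ar _]] := bal_bound a; have [s [s0 bs _]] := bal_bound b.
have h : meet (r *: b) (s *: a) <= 0.
  have h0 : meet a (r *: b) = 0.
    apply/le_anti/andP; split; first exact: bal_disj_scale.
    by rewrite lexI a0 bal_scaler_ge0 // ltW.
  by apply: bal_disj_scale => //; rewrite ?bal_scaler_ge0 ?(ltW r0) // meetC.
apply: le_trans h; rewrite lexI; apply/andP; split.
  by rewrite -[in leRHS](mul1r b) bal_scaleAl; exact: lr_ler_pMr.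
by rewrite -[in leRHS](mulr1 a) bal_scaleAr; exact: lr_ler_pMl.
Qed.

(** The cross terms between positive and negative part vanish, so the square is a sum of two
    positive squares. *)
Lemma bal_sqr_ge0 a : 0 <= a * a.
Proof.
have p0 := pos_part_ge0 a; have q0 := pos_part_ge0 (- a).
have pq := bal_disj_mul p0 q0 (pos_part_disj a).
have qp : pos_part (- a) * pos_part a = 0.
  by apply: bal_disj_mul => //; rewrite meetC pos_part_disj.
rewrite (pos_part_decomp a) mulrBl !mulrBr pq qp subr0 sub0r opprK.
by apply: lr_addr_ge0; apply: lring_mulr_ge0.
Qed.

(** The order-theoretic form of an idempotent; [component_idempotent] proves the equivalence. *)
Definition component u := meet u (1 - u) = 0.

Lemma component_ge0 u : component u -> 0 <= u.
Proof. by move=> <-; exact: leIl. Qed.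

Lemma component_compl_ge0 u : component u -> 0 <= 1 - u.
Proof. by move=> <-; exact: leIr. Qed.

Lemma component_le1 u : component u -> u <= 1.
Proof. by move=> /component_compl_ge0; rewrite lr_subge0. Qed.

Lemma component_compl u : component u -> component (1 - u).
Proof. by rewrite /component subKr meetC. Qed.

(** The difference x - u x = (1 - u) x lies below both u and 1 - u, hence is 0. *)
Lemma component_mull u x : component u -> 0 <= x -> x <= u -> u * x = x.
Proof.
move=> cu x0 xu; apply/eqP; rewrite eq_sym -subr_eq0 -{1}[x]mul1r -mulrBl.
have c0 := component_compl_ge0 cu; have u0 := component_ge0 cu.
apply/eqP/le_anti; rewrite lring_mulr_ge0 // andbT -cu lexI; apply/andP; split.
  rewrite mulrBl mul1r lr_leBlE (le_trans xu) //.
  by rewrite -{1}[u]addr0 lr_leD2lE lring_mulr_ge0.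
rewrite -[X in _ <= X]mulr1; apply: lr_ler_pMl => //.
exact: le_trans xu (component_le1 cu).
Qed.

Lemma component_mulr u x : component u -> 0 <= x -> x <= u -> x * u = x.
Proof.
move=> cu x0 xu; apply/eqP; rewrite eq_sym -subr_eq0 -{1}[x]mulr1 -mulrBr.
have c0 := component_compl_ge0 cu; have u0 := component_ge0 cu.
apply/eqP/le_anti; rewrite lring_mulr_ge0 // andbT -cu lexI; apply/andP; split.
  rewrite mulrBr mulr1 lr_leBlE (le_trans xu) //.
  by rewrite -{1}[u]addr0 lr_leD2lE lring_mulr_ge0.
rewrite -[X in _ <= X]mul1r; apply: lr_ler_pMr => //.
exact: le_trans xu (component_le1 cu).
Qed.

(** For the converse, u and 1 - u are squares, hence positive. With x their meet, x = x (1 - u) + x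
    u, and the two terms are at most u (1 - u) = 0 and (1 - u) u = 0. *)
Lemma component_idempotent u : component u <-> is_idempotent u.
Proof.
split=> [cu|uu]; first exact: component_mull (component_ge0 cu) (lexx u).
have vv : (1 - u) * (1 - u) = 1 - u.
  by rewrite mulrBr mulr1 mulrBl mul1r uu subrr subr0.
have u0 : 0 <= u by rewrite -uu bal_sqr_ge0.
have v0 : 0 <= 1 - u by rewrite -vv bal_sqr_ge0.
apply/le_anti/andP; split; last by rewrite lexI u0.
set x := meet _ _; have x0 : 0 <= x by rewrite lexI u0.
have -> : x = x * (1 - u) + x * u by rewrite -mulrDr subrK mulr1.
rewrite -[0]addr0; apply: lr_leD.
  apply: le_trans (lr_ler_pMr v0 (leIl _ _)) _.
  by rewrite mulrBr mulr1 uu subrr.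
apply: le_trans (lr_ler_pMr u0 (leIr _ _)) _.
by rewrite mulrBl mul1r uu subrr.
Qed.

(** The complement of the meet is at most (1 - u) + (1 - e), and the meet is disjoint from each
    summand. *)
Lemma component_meet u e : component u -> component e -> component (meet u e).
Proof.
move=> cu ce; have [u0 e0] := (component_ge0 cu, component_ge0 ce).
have [u1 e1] := (component_compl_ge0 cu, component_compl_ge0 ce).
have x0 : 0 <= meet u e by rewrite lexI u0.
have xle : meet u e <= 1.
  exact: le_trans (leIl _ _) (component_le1 cu).
apply/le_anti/andP; split; last by rewrite lexI x0 lr_subge0.
have h : 1 - meet u e <= (1 - u) + (1 - e).
  rewrite lr_leBlE addrC -lr_leBlE opprD opprB addrA addrCA subrr addr0.
  rewrite lexI !lr_leBlE -{1}[u]addr0 lr_leD2lE e1 /=.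
  by rewrite addrC subrK component_le1.
apply: le_trans (leI2 (lexx _) h) _.
apply: le_trans (lr_meetD_le x0 u1 e1) _; rewrite -[0]addr0; apply: lr_leD.
  by rewrite -cu; exact: leI2 (leIl _ _) (lexx _).
by rewrite -ce; exact: leI2 (leIr _ _) (lexx _).
Qed.

Lemma component_idempotent_le u e : component u -> component e ->
  idempotent_le u e <-> u <= e.
Proof.
move=> cu ce; split=> [<-|]; last exact/component_mulr/component_ge0.
rewrite -[leRHS]mul1r.
by apply: lr_ler_pMr; [exact: component_ge0|exact: component_le1].
Qed.

Lemma component_disj u b : component u -> 0 <= b -> meet u b = 0 <-> u * b = 0.
Proof.
move=> cu b0; have u0 := component_ge0 cu.
split=> [|ub]; first exact: bal_disj_mul.
apply/le_anti/andP; split; last by rewrite lexI u0.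
have x0 : 0 <= meet u b by rewrite lexI u0.
by rewrite -(component_mull cu x0 (leIl _ _)) -ub; exact: lr_ler_pMl (leIr _ _).
Qed.

End BalTheory.

(** * Atoms of a basic algebra *)

Section BasicAlgebra.
Variables (R : realType) (B : balType R).
Hypothesis dcB : dedekind_complete B.
Implicit Types (a b c u : B) (r s : R).

(* If g is disjoint from b then so is 2g /\ 1, hence the largest such g below 1
   is a component of 1. *)
Lemma pseudo_complement b : 0 <= b -> exists u,
  [/\ component u, meet u b = 0 &
      forall g : B, 0 <= g -> g <= 1 -> meet g b = 0 -> g <= u].
Proof.
move=> b0; pose S := [set g : B | [/\ 0 <= g, g <= 1 & meet g b = 0]].
have S0 : S 0 by split; rewrite ?bal_ler01 //; exact/meet_l.
have [|u [ubu lbu]] := dcB (ex_intro _ _ S0); first by exists 1 => g [].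
have u0 : 0 <= u := ubu _ S0.
have u1 : u <= 1 by apply: lbu => g [].
have ub0 : meet u b = 0.
  apply/le_anti/andP; split; last by rewrite lexI u0.
  (* Each g in S is disjoint from h <= b, so g + h is the join of g and h and stays below u; thus u
     - h still bounds S, which forces h <= 0. *)
  set h := meet u b; suff : u <= u - h.
    by rewrite lr_leBrE -{2}[u]addr0 lr_leD2lE.
  apply: lbu => g Sg; have [g0 g1 gb] := Sg.
  have gh : meet g h = 0.
    apply/le_anti/andP; split; last by rewrite !lexI g0 u0.
    by rewrite -gb; exact: leI2 (lexx _) (leIr _ _).
  by rewrite lr_leBrE -lr_joinDmeet gh addr0 leUx leIl ubu.
exists u; split=> // [|g g0 g1 gb]; last exact: ubu.
apply/le_anti/andP; split; last by rewrite lexI u0 lr_subge0.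
rewrite -(lr_leD2rE _ _ u) add0r lr_meetDr subrK; apply: ubu; split.
- by rewrite lexI bal_ler01 lr_addr_ge0.
- exact: leIr.
- apply/le_anti/andP; split; last by rewrite !lexI b0 bal_ler01 lr_addr_ge0.
  have /(_ 2%N) <- := fun n => @lr_meetMn0 _ b u n b0 u0 (etrans (meetC _ _) ub0).
  by rewrite meetC mulr2n; exact: leI2 (lexx _) (leIl _ _).
Qed.

Section Atom.
Variable e : B.
Hypothesis atom_e : is_idempotent_atom e.

Lemma atom_component : component e.
Proof. by case: atom_e => /component_idempotent. Qed.

Lemma atom_neq0 : e <> 0.
Proof. by case: atom_e. Qed.

Lemma atom_ge0 : 0 <= e.
Proof. exact: component_ge0 atom_component. Qed.

Lemma atom_meet u : component u -> meet e u = 0 \/ e <= u.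
Proof.
move=> cu; have cm := component_meet atom_component cu.
have [_ _ /(_ (meet e u))] := atom_e; case.
- exact/component_idempotent.
- exact/(component_idempotent_le cm atom_component)/leIl.
- by left.
- by move=> <-; right; exact: leIr.
Qed.

(** Let u be the largest component disjoint from b. An atom below u annihilates b. An atom disjoint
    from u is disjoint from a, because u dominates the meet of a and 1. *)
Lemma atom_dichotomy a b : 0 <= a -> 0 <= b -> meet a b = 0 ->
  e * a = 0 \/ e * b = 0.
Proof.
move=> a0 b0 ab; have [u [cu ub hu]] := pseudo_complement b0.
have [eu0|eu] := atom_meet cu; [left|right]; last first.
  apply/component_disj; rewrite ?atom_component //; first exact: atom_component.
  apply/le_anti/andP; split; last by rewrite lexI atom_ge0.
  by rewrite -ub; exact: leI2 eu (lexx _).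
apply/component_disj => //; first exact: atom_component.
apply/le_anti/andP; split; last by rewrite lexI atom_ge0.
rewrite -eu0 lexI leIl; apply: le_trans (hu (meet a 1) _ _ _).
- rewrite lexI leIr (le_trans (leIl _ _)) //.
  exact: component_le1 atom_component.
- by rewrite lexI a0 bal_ler01.
- exact: leIr.
- apply/le_anti/andP; split; last by rewrite !lexI a0 b0 bal_ler01.
  by rewrite -ab; exact: leI2 (leIl _ _) (lexx _).
Qed.

Lemma atom_scale_le r s : (r *: e <= s *: e) = (r <= s).
Proof. exact: bal_scale_le atom_ge0 atom_neq0. Qed.

Lemma atom_scale_inj : injective ( *:%R^~ e : R -> B).
Proof.
by move=> r s rs; apply/le_anti; rewrite -!atom_scale_le /= rs lexx.
Qed.

(** The dichotomy applied to the positive and negative parts of b - r. *)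
Lemma atom_scale_total b r : r *: e <= e * b \/ e * b <= r *: e.
Proof.
have eE : e * (r *: (1 : B)) = r *: e by rewrite -bal_scaleAr mulr1.
pose d := b - r *: (1 : B).
have [h|h] := atom_dichotomy (pos_part_ge0 d) (pos_part_ge0 (- d))
  (pos_part_disj d).
- right; rewrite -eE -lr_subge0 -mulrBr -opprB mulrN -/d (pos_part_decomp d).
  rewrite mulrBr h sub0r opprK.
  by apply: lring_mulr_ge0; [exact: atom_ge0|exact: pos_part_ge0].
- left; rewrite -eE -lr_subge0 -mulrBr -/d (pos_part_decomp d) mulrBr h subr0.
  by apply: lring_mulr_ge0; [exact: atom_ge0|exact: pos_part_ge0].
Qed.

(** The eigenvalue is the supremum of a cut, nonempty and bounded because b is. Totality gives e b
    <= (sup + d) e, adherence gives (sup - d) e <= e b, and the archimedean property removes d. *)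
Lemma atom_eigen b : exists r, e * b = r *: e.
Proof.
have [n [n0 bn nb]] := bal_bound b.
have le_n c : c <= n *: (1 : B) -> e * c <= n *: e.
  move=> /(lr_ler_pMl atom_ge0); by rewrite -bal_scaleAr mulr1.
pose E := [set r | r *: e <= e * b].
have En : E (- n).
  by rewrite /E /= scaleNr lr_leNl -mulrN; exact: le_n.
have ubE : has_ubound E.
  by exists n => r /= /le_trans/(_ (le_n _ bn)); rewrite atom_scale_le.
have supE : has_sup E by split => //; exists (- n).
exists (sup E); apply/eqP; rewrite -subr_eq0; apply/eqP/le_anti/andP; split.
  apply: (bal_arch_eps atom_ge0) => d d0.
  rewrite lr_leBlE addrC -scalerDl.
  have [h|//] := atom_scale_total b (sup E + d).
  have : sup E + d <= sup E by apply: ub_le_sup.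
  by rewrite -[leRHS]addr0 lerD2l leNgt d0.
rewrite -lr_leN2E oppr0 opprB; apply: (bal_arch_eps atom_ge0) => d d0.
have [r Er dr] := sup_adherent d0 supE.
rewrite lr_leBlE addrC -lr_leBlE -scalerBl; apply: le_trans Er.
by rewrite atom_scale_le ltW.
Qed.

End Atom.
End BasicAlgebra.

(** * Algebras of functions *)

Section RealBal.
Variable R : realType.

Definition real_lring_data : lringData :=
  LRingData (lring_lattice := Order.Lattice.clone ring_display R _)
    (@GRing.isPzRing.Build R 0 -%R +%R 1 *%R (@addrA R) (@addrC R) (@add0r R)
       (@addNr R) (@mulrA R) (@mul1r R) (@mulr1 R) (@mulrDl R) (@mulrDr R)).

Lemma real_leD2r (a b c : real_lring_data) : a <= b -> a + c <= b + c.
Proof. by move=> ab; have := lerD (ab : (a : R) <= b) (lexx (c : R)). Qed.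

Lemma real_mulr_ge0 (a b : real_lring_data) : 0 <= a -> 0 <= b -> 0 <= a * b.
Proof. exact: (@mulr_ge0 R). Qed.

Definition real_lring : lringType := LRing real_leD2r real_mulr_ge0.

Definition real_lalgebra_data : lalgebraData R :=
  @LAlgebraData R real_lring
    (@GRing.Zmodule_isLmodule.Build R (lring_sort real_lring) *%R
       (@mulrA R) (@mul1r R)
       (@mulrDr R) (fun v a b => @mulrDl R a b v)).

Definition real_lalgebra : lalgebraType R.
Proof.
exists real_lalgebra_data; [exact: (@mulrA R)|exact: (@mulrCA R)|].
exact: (@mulr_ge0 R).
Defined.

Lemma real_natr (n : nat) : (n%:R : real_lalgebra) = n%:R :> R.
Proof. by elim: n => [//|n ih]; rewrite mulrS [RHS]mulrS -ih. Qed.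

Lemma real_mulrn (a : R) (n : nat) : ((a : real_lalgebra) *+ n) = a *+ n :> R.
Proof. by elim: n => [//|n ih]; rewrite mulrS [RHS]mulrS -ih. Qed.

Lemma real_bounded : lring_bounded real_lalgebra.
Proof.
move=> a; exists (Num.truncn `|a : R|).+1.
rewrite real_natr; apply: le_trans (ler_norm (a : R)) _.
by rewrite ltW // truncnS_gt.
Qed.

Lemma real_archimedean : lring_archimedean real_lalgebra.
Proof.
move=> a b h; suff : (a : R) <= 0 by [].
rewrite leNgt; apply/negP => a0.
have := h (Num.truncn `|(b : R) / a|).+1; rewrite real_mulrn; apply/negP.
rewrite -ltNge -[X in _ < X]mulr_natl -ltr_pdivrMr //.
exact: le_lt_trans (ler_norm _) (truncnS_gt _).
Qed.

Definition real_bal : balType R := Bal real_bounded real_archimedean.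

End RealBal.

Section FunctionAlgebra.
Variables (R : realType) (I : Type) (V : balType R).

(** The codomain V is arbitrary so that one construction yields bounded and continuous real
    functions as well as the kernel pair, whose elements are functions from [bool] to an algebra. *)
Record function_algebra (P : set (I -> V)) := FunctionAlgebra {
  fun_alg_bounded : forall f, P f -> exists n : nat, forall i, f i <= n%:R;
  fun_alg1 : P (fun=> 1);
  fun_algD : forall f g, P f -> P g -> P (fun i => f i + g i);
  fun_algM : forall f g, P f -> P g -> P (fun i => f i * g i);
  fun_algZ : forall r f, P f -> P (fun i => r *: f i);
  fun_alg_join : forall f g, P f -> P g -> P (fun i => join (f i) (g i)) }.

Variables (P : set (I -> V)) (algP : function_algebra P).

(** The closure proof is a parameter of the type, so that the structures declared on it can refer to
    that proof. *)
Definition fun_alg of function_algebra P : Type := {f : I -> V | P f}.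
Local Notation F := (fun_alg algP).

Definition fun_alg_val (f : F) : I -> V := sval f.
Local Coercion fun_alg_val : fun_alg >-> Funclass.

Lemma fun_alg_ext (f g : F) : f =1 g -> f = g.
Proof. by case: f g => [f Pf] [g Pg] /funext; exact: eq_exist. Qed.

Lemma fun_alg_opp f : P f -> P (fun i => - f i).
Proof. by move=> /(fun_algZ algP (-1)); under eq_fun do rewrite scaleN1r. Qed.

Lemma fun_alg0 : P (fun=> 0).
Proof.
by have := fun_algZ algP 0 (fun_alg1 algP); under eq_fun do rewrite scale0r.
Qed.

Lemma fun_alg_meet f g : P f -> P g -> P (fun i => meet (f i) (g i)).
Proof.
move=> /fun_alg_opp Pf /fun_alg_opp Pg.
have := fun_alg_opp (fun_alg_join algP Pf Pg).
by under eq_fun do rewrite lr_oppU !opprK.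
Qed.

HB.instance Definition _ := gen_eqMixin F.
HB.instance Definition _ := gen_choiceMixin F.

Definition fun_le (f g : F) : bool := `[< forall i, f i <= g i >].

Lemma fun_leP (f g : F) : reflect (forall i, f i <= g i) (fun_le f g).
Proof. exact: asboolP. Qed.

Lemma fun_le_refl : reflexive fun_le.
Proof. by move=> f; apply/fun_leP. Qed.

Lemma fun_le_anti : antisymmetric fun_le.
Proof.
move=> f g /andP[/fun_leP fg /fun_leP gf]; apply: fun_alg_ext => i.
by apply/le_anti; rewrite fg gf.
Qed.

Lemma fun_le_trans : transitive fun_le.
Proof.
move=> g f h /fun_leP fg /fun_leP gh; apply/fun_leP => i.
exact: le_trans (fg i) (gh i).
Qed.

HB.instance Definition _ := Order.Le_isPOrder.Build ring_display F
  fun_le_refl fun_le_anti fun_le_trans.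

Definition fun_meet (f g : F) : F :=
  exist _ _ (fun_alg_meet (svalP f) (svalP g)).
Definition fun_join (f g : F) : F :=
  exist _ _ (fun_alg_join algP (svalP f) (svalP g)).

Lemma fun_meetP (h f g : F) :
  (h <= fun_meet f g) = (h <= f) && (h <= g).
Proof.
apply/fun_leP/andP => [hfg|[/fun_leP hf /fun_leP hg] i]; last first.
  by rewrite lexI hf hg.
by split; apply/fun_leP => i; have := hfg i; rewrite lexI => /andP[].
Qed.

Lemma fun_joinP (f g h : F) :
  (fun_join f g <= h) = (f <= h) && (g <= h).
Proof.
apply/fun_leP/andP => [hfg|[/fun_leP hf /fun_leP hg] i]; last first.
  by rewrite leUx hf hg.
by split; apply/fun_leP => i; have := hfg i; rewrite leUx => /andP[].
Qed.

HB.instance Definition _ :=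
  Order.POrder_MeetJoin_isLattice.Build ring_display F fun_meetP fun_joinP.

Definition fun_zero : F := exist _ _ fun_alg0.
Definition fun_one : F := exist _ _ (fun_alg1 algP).
Definition fun_opp (f : F) : F := exist _ _ (fun_alg_opp (svalP f)).
Definition fun_add (f g : F) : F := exist _ _ (fun_algD algP (svalP f) (svalP g)).
Definition fun_mul (f g : F) : F := exist _ _ (fun_algM algP (svalP f) (svalP g)).
Definition fun_scale (r : R) (f : F) : F := exist _ _ (fun_algZ algP r (svalP f)).

Lemma fun_addA : associative fun_add.
Proof. by move=> f g h; apply: fun_alg_ext => i; exact: addrA. Qed.
Lemma fun_addC : commutative fun_add.
Proof. by move=> f g; apply: fun_alg_ext => i; exact: addrC. Qed.
Lemma fun_add0 : left_id fun_zero fun_add.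
Proof. by move=> f; apply: fun_alg_ext => i; exact: add0r. Qed.
Lemma fun_addN : left_inverse fun_zero fun_opp fun_add.
Proof. by move=> f; apply: fun_alg_ext => i; exact: addNr. Qed.
Lemma fun_mulA : associative fun_mul.
Proof. by move=> f g h; apply: fun_alg_ext => i; exact: mulrA. Qed.
Lemma fun_mul1 : left_id fun_one fun_mul.
Proof. by move=> f; apply: fun_alg_ext => i; exact: mul1r. Qed.
Lemma fun_mulr1 : right_id fun_one fun_mul.
Proof. by move=> f; apply: fun_alg_ext => i; exact: mulr1. Qed.
Lemma fun_mulDl : left_distributive fun_mul fun_add.
Proof. by move=> f g h; apply: fun_alg_ext => i; exact: mulrDl. Qed.
Lemma fun_mulDr : right_distributive fun_mul fun_add.
Proof. by move=> f g h; apply: fun_alg_ext => i; exact: mulrDr. Qed.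

Definition fun_lring_data : lringData :=
  LRingData (lring_lattice := Order.Lattice.clone ring_display F _)
    (@GRing.isPzRing.Build F fun_zero fun_opp fun_add fun_one fun_mul
       fun_addA fun_addC fun_add0 fun_addN fun_mulA fun_mul1 fun_mulr1
       fun_mulDl fun_mulDr).

Lemma fun_leD2r (f g h : fun_lring_data) : f <= g -> f + h <= g + h.
Proof. by move=> /fun_leP fg; apply/fun_leP => i; exact: lring_leD2r. Qed.

Lemma fun_mulr_ge0 (f g : fun_lring_data) : 0 <= f -> 0 <= g -> 0 <= f * g.
Proof.
move=> /fun_leP f0 /fun_leP g0; apply/fun_leP => i.
exact: lring_mulr_ge0 (f0 i) (g0 i).
Qed.

Definition fun_lring : lringType := LRing fun_leD2r fun_mulr_ge0.

Lemma fun_scaleA a b (f : fun_lring) :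
  fun_scale a (fun_scale b f) = fun_scale (a * b) f.
Proof. by apply: fun_alg_ext => i; exact: scalerA. Qed.
Lemma fun_scale1 : left_id 1 fun_scale.
Proof. by move=> f; apply: fun_alg_ext => i; exact: scale1r. Qed.
Lemma fun_scaleDr :
  right_distributive (fun_scale : R -> fun_lring -> fun_lring) +%R.
Proof. by move=> a f g; apply: fun_alg_ext => i; exact: scalerDr. Qed.
Lemma fun_scaleDl (f : fun_lring) :
  {morph (fun_scale : R -> fun_lring -> fun_lring)^~ f : a b / a + b}.
Proof. by move=> a b; apply: fun_alg_ext => i; exact: scalerDl. Qed.

Definition fun_lalgebra_data : lalgebraData R :=
  @LAlgebraData R fun_lring
    (@GRing.Zmodule_isLmodule.Build R (lring_sort fun_lring) fun_scale
       fun_scaleA fun_scale1 fun_scaleDr fun_scaleDl).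

Definition fun_lalgebra : lalgebraType R.
Proof.
exists fun_lalgebra_data.
- by move=> r f g; apply: fun_alg_ext => i; exact: bal_scaleAl.
- by move=> r f g; apply: fun_alg_ext => i; exact: bal_scaleAr.
- move=> r f r0 /fun_leP f0; apply/fun_leP => i.
  exact: bal_scaler_ge0 r0 (f0 i).
Defined.

Lemma fun_mulrnE (f : fun_lalgebra) (n : nat) i :
  fun_alg_val (f *+ n) i = fun_alg_val f i *+ n.
Proof. by elim: n => [//|n ih]; rewrite mulrS [RHS]mulrS -ih. Qed.

Lemma fun_bounded : lring_bounded fun_lalgebra.
Proof.
move=> f; have [n hn] := fun_alg_bounded algP (svalP f).
by exists n; apply/fun_leP => i; rewrite fun_mulrnE; exact: hn.
Qed.

Lemma fun_archimedean : lring_archimedean fun_lalgebra.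
Proof.
move=> f g h; apply/fun_leP => i.
apply: (@bal_archimedean _ V (fun_alg_val f i) (fun_alg_val g i)) => n.
by have /fun_leP/(_ i) := h n; rewrite fun_mulrnE.
Qed.

Definition fun_bal : balType R := Bal fun_bounded fun_archimedean.

End FunctionAlgebra.

(** * Homomorphisms: construction, order, inverses *)

Section BalHomTheory.
Variables (R : realType) (A B : balType R).

Section Build.
Variable f : A -> B.
Hypotheses (fB : {morph f : a b / a - b}) (f1 : f 1 = 1).
Hypotheses (fM : {morph f : a b / a * b}) (fZ : scalable f).
Hypothesis fU : {morph f : a b / join a b}.

Let f_rmorphism : {rmorphism A -> B} :=
  HB.pack f (GRing.isZmodMorphism.Build _ _ f fB)
            (GRing.isMonoidMorphism.Build _ _ f (f1, fM)).

Let f_meet : Order.meet_morphism f_rmorphism.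
Proof.
have fN a : f (- a) = - f a by rewrite -sub0r fB -(subrr 0) fB subrr sub0r.
by move=> a b; rewrite /= -[meet a b]opprK lr_oppI fN fU !fN lr_oppU !opprK.
Qed.

Definition mk_balHom : balHom A B :=
  BalHom (balHom_rmorphism := f_rmorphism) fZ f_meet fU.

End Build.

Lemma balHom_le (f : balHom A B) a b : a <= b -> f a <= f b.
Proof. by rewrite !leEjoin -balHom_join => /eqP ->. Qed.

Lemma balHom_leE (f : balHom A B) a b : injective f -> (f a <= f b) = (a <= b).
Proof.
move=> fI; apply/idP/idP; last exact: balHom_le.
by rewrite !leEjoin -balHom_join => /eqP/fI ->.
Qed.

Lemma balHom_scale (f : balHom A B) r a : f (r *: a) = r *: f a.
Proof. exact: balHom_scalable. Qed.

End BalHomTheory.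

Section Inverse.
Variables (R : realType) (A B : balType R).
Variables (f : balHom A B) (g : B -> A) (fK : cancel f g) (gK : cancel g f).

Lemma balHom_inv_sub : {morph g : a b / a - b}.
Proof. by move=> a b; apply: (can_inj fK); rewrite gK rmorphB !gK. Qed.
Lemma balHom_inv1 : g 1 = 1.
Proof. by apply: (can_inj fK); rewrite gK rmorph1. Qed.
Lemma balHom_invM : {morph g : a b / a * b}.
Proof. by move=> a b; apply: (can_inj fK); rewrite gK rmorphM !gK. Qed.
Lemma balHom_invZ : scalable g.
Proof. by move=> r a; apply: (can_inj fK); rewrite gK balHom_scale gK. Qed.
Lemma balHom_inv_join : {morph g : a b / join a b}.
Proof. by move=> a b; apply: (can_inj fK); rewrite gK balHom_join !gK. Qed.

Definition balHom_inv : balHom B A :=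
  mk_balHom balHom_inv_sub balHom_inv1 balHom_invM balHom_invZ balHom_inv_join.

(** An isomorphism reflects the order, so an upper bound of the image comes from an upper bound of
    S. *)
Lemma balHom_bij_normal : normal f.
Proof.
move=> S b [ub lb]; split=> [_ [a Sa <-]|c ubc].
  exact/balHom_le/ub.
rewrite -[c]gK; apply/balHom_le/lb => a Sa.
by rewrite -(balHom_leE _ _ (can_inj fK)) gK; apply: ubc; exists a.
Qed.

End Inverse.

Section FunctionAlgebraHom.
Variables (R : realType) (I J : Type) (V : balType R).
Variables (P : set (I -> V)) (algP : function_algebra P).
Variables (Q : set (J -> V)) (algQ : function_algebra Q).

Definition fun_eval (i : I) : balHom (fun_bal algP) V.
Proof.
by apply: (@mk_balHom _ _ _ (fun f : fun_bal algP => fun_alg_val f i)).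
Defined.

Variables (phi : J -> I) (phiPQ : forall f, P f -> Q (f \o phi)).

Definition fun_pullback_fun (f : fun_bal algP) : fun_bal algQ :=
  exist _ _ (phiPQ (svalP f)).

Definition fun_pullback : balHom (fun_bal algP) (fun_bal algQ).
Proof.
by apply: (@mk_balHom _ _ _ fun_pullback_fun) => [f g||f g|r f|f g];
  apply: fun_alg_ext.
Defined.

End FunctionAlgebraHom.

Lemma bal_natr_le (R : realType) (A : balType R) (m n : nat) :
  (m <= n)%N -> (m%:R : A) <= n%:R.
Proof.
move=> /subnKC <-; rewrite natrD -[X in X <= _]addr0 lr_leD2lE.
by apply: lr_mulrn_ge0; exact: bal_ler01.
Qed.

(* The two projections of the kernel pair of f, which lies in bal, are
   equalized by f. *)
Section KernelPair.
Variables (R : realType) (A B : balType R) (f : balHom A B).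

Definition kernel_pair : set (bool -> A) :=
  [set h | f (h true) = f (h false)].

Lemma kernel_pair_alg : function_algebra kernel_pair.
Proof.
split=> [h _||g h|g h|r h|g h]; rewrite /kernel_pair /=.
- have [m hm] := bal_bounded (h true); have [n hn] := bal_bounded (h false).
  exists (m + n)%N => -[].
    exact: le_trans hm (bal_natr_le _ (leq_addr _ _)).
  exact: le_trans hn (bal_natr_le _ (leq_addl _ _)).
- by [].
- by move=> gE hE; rewrite !rmorphD gE hE.
- by move=> gE hE; rewrite !rmorphM gE hE.
- by move=> hE; rewrite !balHom_scale hE.
- by move=> gE hE; rewrite !balHom_join gE hE.
Qed.

Lemma monic_injective : monic (C := bal R) f -> injective f.
Proof.
move=> mf a b fab.
have eqp : bal_comp f (fun_eval kernel_pair_alg true) =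
           bal_comp f (fun_eval kernel_pair_alg false).
  by apply: balHom_ext => h; exact: svalP h.
have /(congr1 (fun g : balHom (fun_bal kernel_pair_alg) A =>
  g (exist _ (fun i : bool => if i then a else b) fab))) := mf _ _ _ eqp.
by [].
Qed.

End KernelPair.

Lemma injective_monic (R : realType) (A B : balType R) (f : balHom A B) :
  injective f -> monic (C := bal R) f.
Proof.
move=> fI C g h fgh; apply: balHom_ext => c; apply: fI.
by have /(congr1 (fun k : balHom C B => k c)) := fgh.
Qed.

(** The set T serves to carry a join-stable property over to the supremum. A is nonempty because a
    lattice need not have a least element. *)
Lemma finite_supremum d (L : latticeType d) (T A : set L) :
  (forall a b, T a -> T b -> T (join a b)) -> finite_set A -> A !=set0 ->
  A `<=` T -> exists2 t, supremums A t & T t.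
Proof.
move=> TU /finite_seqP[[|x s] ->] [//= x0 _] sT.
exists (foldr join x s); first split.
- elim: s {sT} => [|y s ih] z /=; first by rewrite inE => /eqP ->.
  rewrite !inE => /or3P[/eqP zx|/eqP->|zs]; [|exact: leUl|].
    by apply: le_trans (leUr _ _); apply: ih; rewrite /= inE zx eqxx.
  by apply: le_trans (leUr _ _); apply: ih; rewrite /= inE zs orbT.
- elim: s {sT} => [|y s ih] z /= ub; first by apply: ub; rewrite /= mem_head.
  rewrite leUx ub ?ih //=; last by rewrite !inE eqxx orbT.
  move=> w; rewrite /= inE => /orP[/eqP->|ws]; apply: ub;
    by rewrite /= !inE ?eqxx ?ws ?orbT.
- elim: s sT => [|y s ih] sT /=; first by apply: sT; rewrite /= mem_head.
  apply: TU; first by apply: sT; rewrite /= !inE eqxx orbT.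
  apply: ih => w; rewrite /= inE => /orP[/eqP->|ws]; apply: sT;
    by rewrite /= !inE ?eqxx ?ws ?orbT.
Qed.

Lemma finite_infimum d (L : latticeType d) (T A : set L) :
  (forall a b, T a -> T b -> T (meet a b)) -> finite_set A -> A !=set0 ->
  A `<=` T -> exists2 t, infimums A t & T t.
Proof. exact: (@finite_supremum _ L^d). Qed.

(** Near-covering compactness for a filter on lists of points: a set of lists is large when it
    contains every list that includes some fixed [s0], so membership of a given point holds
    eventually. *)
Lemma compact_finite_cover (X : topologicalType) (U : X -> set X) :
  compact [set: X] -> (forall x, nbhs x (U x)) ->
  exists s : seq X, forall y, exists2 x, x \in s & U x y.
Proof.
move=> /compact_near_coveringP cX nU.
pose F : set_system (seq X) :=
  [set P : set (seq X) | exists s0 : seq X, forall s : seq X,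
     {subset s0 <= s} -> P s].
have FF : Filter F.
  split; first by exists [::].
  - move=> P Q [s hs] [t ht]; exists (s ++ t) => u su; split.
      by apply: hs => z zs; apply: su; rewrite mem_cat zs.
    by apply: ht => z zs; apply: su; rewrite mem_cat zs orbT.
  - by move=> P Q PQ [s hs]; exists s => t /hs; exact: PQ.
have [x _|s hs] := cX _ F (fun s y => exists2 x, x \in s & U x y) FF.
  exists (U x, [set s : seq X | x \in s]) => /=; last first.
    by move=> [y s] [/= Uy xs]; exists x.
  by split=> //; exists [:: x] => s; apply; rewrite mem_head.
by exists s => y; exact: (hs s (fun _ => id) y).
Qed.

Section RealFunctionAlgebra.
Variables (R : realType) (X : Type) (P : set (X -> real_bal R)).
Variable algP : function_algebra P.

(** Values are retyped in R, where the order and field lemmas for real numbers apply. *)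
Definition fval (f : fun_bal algP) (x : X) : R :=
  @fun_alg_val _ _ _ _ algP f x.

Lemma fval_ext (f g : fun_bal algP) : fval f =1 fval g -> f = g.
Proof. exact: (@fun_alg_ext _ _ _ _ algP f g). Qed.

Lemma fvalP (f : fun_bal algP) : P (fval f).
Proof. exact: svalP f. Qed.

Lemma fval_le (f g : fun_bal algP) : f <= g <-> forall x, fval f x <= fval g x.
Proof. by split=> [/fun_leP|fg]; [|apply/fun_leP]. Qed.

Lemma fval0 x : fval 0 x = 0. Proof. by []. Qed.
Lemma fval1 x : fval 1 x = 1. Proof. by []. Qed.
Lemma fvalN f x : fval (- f) x = - fval f x. Proof. by []. Qed.
Lemma fvalD f g x : fval (f + g) x = fval f x + fval g x. Proof. by []. Qed.
Lemma fvalM f g x : fval (f * g) x = fval f x * fval g x. Proof. by []. Qed.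
Lemma fvalZ r f x : fval (r *: f) x = r * fval f x. Proof. by []. Qed.
Lemma fval_join f g x : fval (join f g) x = Num.max (fval f x) (fval g x).
Proof. exact: (@joinEtotal _ R). Qed.
Lemma fval_meet f g x : fval (meet f g) x = Num.min (fval f x) (fval g x).
Proof. exact: (@meetEtotal _ R). Qed.

Definition fvalE := (fval0, fval1, fvalN, fvalD, fvalM, fvalZ,
  fval_join, fval_meet).

End RealFunctionAlgebra.

(** * The basic algebra of bounded functions on a set *)

Section BoundedFunctions.
Variables (R : realType) (X : Type).

Definition bounded_funs : set (X -> real_bal R) :=
  [set f | exists M : R, forall x, `|f x : R| <= M].

Lemma bounded_funs_alg : function_algebra bounded_funs.
Proof.
split=> [f [M fM]||f g [M fM] [N gN]|f g [M fM] [N gN]|r f [M fM]|f g [M fM] [N gN]].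
- have [n hn] := @real_bounded R M; exists n => x; apply: le_trans hn.
  exact: le_trans (ler_norm _) (fM x).
- by exists 1 => x; rewrite normr1.
- by exists (M + N) => x; apply: le_trans (ler_normD _ _) _; exact: lerD.
- by exists (M * N) => x; rewrite normrM ler_pM.
- by exists (`|r| * M) => x; rewrite normrM ler_wpM2l.
- exists (Num.max M N) => x.
  have -> : (join (f x) (g x) : R) = Num.max (f x : R) (g x) by exact: joinEtotal.
  rewrite le_max; case: (leP (f x : R) (g x)) => _; first by rewrite gN orbT.
  by rewrite fM.
Qed.

Definition linfty : balType R := fun_bal bounded_funs_alg.

Lemma linfty_ex (f : X -> R) (M : R) : (forall x, `|f x| <= M) ->
  exists g : linfty, fval g = f.
Proof. by move=> fM; exists (exist _ _ (ex_intro _ M fM)). Qed.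

Lemma linfty_bounded (f : linfty) : exists2 M : R, 0 <= M &
  forall x, `|fval f x| <= M.
Proof.
have [M fM] := fvalP f; exists (Num.max 0 M); first by rewrite le_max lexx.
by move=> x; rewrite le_max fM orbT.
Qed.

Lemma linfty_update (f : linfty) x (c : R) : exists g : linfty,
  fval g x = c /\ forall y, y <> x -> fval g y = fval f y.
Proof.
have [M M0 fM] := linfty_bounded f.
pose h y := if `[< y = x >] then c else fval f y.
have [|g gh] := @linfty_ex h (Num.max M `|c|); last first.
  by exists g; rewrite gh /h asboolT //; split=> // y yx; rewrite asboolF.
by rewrite /h => y; case: ifP; rewrite le_max ?lexx ?fM ?orbT.
Qed.

(** Joins are pointwise: if some c < b(x) bounded all values at x, lowering b to c at x alone would
    give a smaller upper bound. *)
Lemma linfty_supP (S : set linfty) b : supremums S b <-> forall x,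
  (forall f, S f -> fval f x <= fval b x) /\
  (forall c, (forall f, S f -> fval f x <= c) -> fval b x <= c).
Proof.
split=> [[ub lb] x|h].
  split=> [f /ub /fval_le //|c hc]; rewrite leNgt; apply/negP => cb.
  have [g [gx gy]] := linfty_update b x c.
  have : ubound S g.
    move=> f Sf; apply/fval_le => y; have [->|yx] := pselect (y = x).
      by rewrite gx hc.
    by rewrite gy //; have /fval_le := ub _ Sf.
  by move=> /lb /fval_le/(_ x); rewrite gx leNgt cb.
split=> [f Sf|c hc]; apply/fval_le => x; have [ub lb] := h x; first exact: ub.
by apply: lb => f /hc /fval_le.
Qed.

Lemma linfty_infP (S : set linfty) b : infimums S b <-> forall x,
  (forall f, S f -> fval b x <= fval f x) /\
  (forall c, (forall f, S f -> c <= fval f x) -> c <= fval b x).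
Proof.
split=> [[ub lb] x|h].
  split=> [f /ub /fval_le //|c hc]; rewrite leNgt; apply/negP => cb.
  have [g [gx gy]] := linfty_update b x c.
  have : lbound S g.
    move=> f Sf; apply/fval_le => y; have [->|yx] := pselect (y = x).
      by rewrite gx hc.
    by rewrite gy //; have /fval_le := ub _ Sf.
  by move=> /lb /fval_le/(_ x); rewrite gx leNgt cb.
split=> [f Sf|c hc]; apply/fval_le => x; have [ub lb] := h x; first exact: ub.
by apply: lb => f /hc /fval_le.
Qed.

Lemma linfty_dedekind : dedekind_complete linfty.
Proof.
move=> S [f0 Sf0] [u Su]; pose E x := [set fval f x | f in S].
have supE x : has_sup (E x).
  split; first by exists (fval f0 x), f0.
  by exists (fval u x) => _ [f /Su /fval_le fu <-].
have [M M0 fM] := linfty_bounded f0; have [N N0 uN] := linfty_bounded u.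
have [|b bE] := @linfty_ex (fun x => sup (E x)) (M + N).
  move=> x; have f0b : fval f0 x <= sup (E x).
    by apply: ub_le_sup; [case: (supE x)|exists f0].
  have bu : sup (E x) <= fval u x.
    by apply: ge_sup; [case: (supE x)|move=> _ [f /Su /fval_le fu <-]].
  rewrite ler_norml; apply/andP; split.
    apply: le_trans f0b; have := fM x; rewrite ler_norml => /andP[+ _].
    by apply: le_trans; rewrite lerN2 lerDl.
  apply: le_trans bu _; apply: le_trans (ler_norm _) _.
  by apply: le_trans (uN x) _; rewrite lerDr.
exists b; apply/linfty_supP => x; rewrite bE; split=> [f Sf|c hc].
  by apply: ub_le_sup; [case: (supE x)|exists f].
by apply: ge_sup; [case: (supE x)|move=> _ [f /hc fc <-]].
Qed.

Lemma linfty_delta x : exists e : linfty,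
  fval e x = 1 /\ forall y, y <> x -> fval e y = 0.
Proof. exact: (linfty_update 0 x 1). Qed.

Lemma linfty_idempotent (f : linfty) x : is_idempotent f ->
  fval f x = 0 \/ fval f x = 1.
Proof.
move=> /(congr1 (fun k : linfty => fval k x)); rewrite fvalM => /eqP.
rewrite -[X in _ == X]mulr1 -subr_eq0 -mulrBr mulf_eq0 subr_eq0.
by move=> /orP[] /eqP; [left|right].
Qed.

(** A nonzero idempotent takes the value 1 at some x, and the indicator of x is an atom below it. *)
Lemma linfty_atomic : idempotents_atomic linfty.
Proof.
move=> f ff f0; have [x fx] : exists x, fval f x <> 0.
  by apply/existsNP => h; apply: f0; apply: fval_ext => x; rewrite h.
have {}fx : fval f x = 1 by case: (linfty_idempotent x ff).
have [e [ex ey]] := linfty_delta x; exists e; first split.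
- apply: fval_ext => y; rewrite fvalM; have [->|/ey ->] := pselect (y = x).
    by rewrite ex mulr1.
  by rewrite mulr0.
- move=> /(congr1 (fun k : linfty => fval k x)); rewrite ex fval0 => /eqP.
  by rewrite oner_eq0.
- move=> g gg ge; have gy y : y <> x -> fval g y = 0.
    by move=> yx; rewrite -ge fvalM ey // mulr0.
  have [gx|gx] := linfty_idempotent x gg; [left|right]; apply: fval_ext => y;
    have [->|yx] := pselect (y = x); rewrite ?gx ?ex ?gy ?ey //.
- apply: fval_ext => y; rewrite fvalM; have [->|/ey ->] := pselect (y = x).
    by rewrite fx mulr1.
  by rewrite mul0r.
Qed.

Lemma linfty_basic : basic_algebra linfty.
Proof. by split; [exact: linfty_dedekind|exact: linfty_atomic]. Qed.

End BoundedFunctions.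

(** * Continuous functions on a compact space *)

Section ContinuousFunctions.
Variables (R : realType) (X : topologicalType).
Hypothesis cX : compact [set: X].

Definition cont_funs : set (X -> real_bal R) := [set f | continuous (f : X -> R)].

Lemma continuous_bounded (f : X -> R) : continuous f -> @bounded_funs R X f.
Proof.
move=> cf; have [|s hs] := @compact_finite_cover X
    (fun x => [set y | `|f x - f y| < 1]) cX.
  by move=> x; have /cvgrPdist_lt/(_ _ ltr01) := cf x.
(* Every y is within oscillation 1 of a listed x; the sum dominates each [|f x|]. *)
exists (1 + \sum_(x <- s) `|f x|) => y; have [x xs fxy] := hs y.
rewrite -[X in `|X : R|](subrKC (f x)) addrC; apply: le_trans (ler_normD _ _) _.
rewrite distrC; apply: lerD; first exact: ltW.
by rewrite (big_rem x) //= lerDl sumr_ge0.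
Qed.

Lemma cont_funs_alg : function_algebra cont_funs.
Proof.
split=> [f /continuous_bounded Bf||f g cf cg|f g cf cg|r f cf|f g cf cg].
- exact: (fun_alg_bounded (bounded_funs_alg R X)) _ Bf.
- by move=> x; exact: cvg_cst.
- by move=> x; apply: cvgD; [exact: cf|exact: cg].
- by move=> x; apply: cvgM; [exact: cf|exact: cg].
- by move=> x; apply: cvgM; [exact: cvg_cst|exact: cf].
- have fE : (fun x => join (f x) (g x)) =
      (fun x => Num.max (f x : R) (g x : R)).
    by apply/funext => x; exact: joinEtotal.
  by rewrite /cont_funs /= fE => x; apply: continuous_max; [exact: cf|exact: cg].
Qed.

Definition cont_alg : balType R := fun_bal cont_funs_alg.

Lemma fval_continuous (f : cont_alg) : continuous (fval f).
Proof. exact: fvalP f. Qed.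

Lemma cont_ex (f : X -> R) : continuous f -> exists g : cont_alg, fval g = f.
Proof. by move=> cf; exists (exist _ _ cf). Qed.

Definition cont_incl : balHom cont_alg (linfty R X) :=
  fun_pullback cont_funs_alg (bounded_funs_alg R X) (phi := id)
    continuous_bounded.

Lemma cont_inclE f : fval (cont_incl f) = fval f.
Proof. by []. Qed.

Lemma cont_incl_inj : injective cont_incl.
Proof.
move=> f g /(congr1 (fun k : linfty R X => fval k)) fg.
by apply: fval_ext => x; rewrite -!cont_inclE fg.
Qed.

End ContinuousFunctions.

(** * The compact basic extension of a compact Hausdorff space *)

Section BalNorm.
Variables (R : realType) (A : balType R).
Implicit Types (a : A) (r e : R).

Lemma bal_trivial (a b : A) : (1 : A) = 0 -> a = b.
Proof. by move=> A0; rewrite -[a]mulr1 -[b]mulr1 A0 !mulr0. Qed.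

Lemma bal_norm_set_lb a : (1 : A) <> 0 ->
  lbound [set r : R | join a (- a) <= r *: (1 : A)] 0.
Proof.
move=> A1 r /= /(le_trans (bal_abs_ge0 a)).
by rewrite -{1}[0](scale0r (1 : A)) bal_scale_le // bal_ler01.
Qed.

Lemma bal_norm_lt a e : bal_norm a < e -> join a (- a) <= e *: (1 : A).
Proof.
move=> ae; have [|r /= ar re] := inf_lt _ ae.
  by have [r [_ r1 r2]] := bal_bound a; exists r; rewrite /= leUx r1.
by apply: le_trans ar _; apply: bal_ler_wZr (bal_ler01 A) (ltW re).
Qed.

Lemma bal_norm_le a r : 0 <= r -> join a (- a) <= r *: (1 : A) -> bal_norm a <= r.
Proof.
move=> r0 ar; have [A0|A1] := pselect ((1 : A) = 0).
  have ubA (M : R) : ~ lbound [set r : R | join a (- a) <= r *: (1 : A)] M.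
    move=> /(_ (M - 1)) /=.
    rewrite (bal_trivial (join a (- a)) ((M - 1) *: (1 : A)) A0) lexx => /(_ isT).
    by rewrite lerBrDr gerDl ler10.
  by rewrite /bal_norm inf_out // => -[_ [M]] /ubA.
by apply: ge_inf => //; exists 0; exact: bal_norm_set_lb.
Qed.

End BalNorm.

Section CompactExtension.
Variables (R : realType) (X : topologicalType).
Hypotheses (cX : compact [set: X]) (hX : hausdorff_space X).

Lemma urysohn_point_closed (x : X) (C : set X) : closed C -> ~ C x ->
  exists f : X -> R, [/\ continuous f, forall y, 0 <= f y <= 1, f x = 1 &
    forall y, C y -> f y = 0].
Proof.
move=> clC Cx.
have us : uniform_separator [set x] C.
  apply: (@normal_completely_regular R) => //.
  - exact: compact_normal.
  - exact: hausdorff_accessible.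
have [f [cf f01 fx fC]] := (@uniform_separatorP _ R _ _).1 us.
(* The separator is 0 at x and 1 on C, hence the flip. *)
exists (fun y => 1 - f y); split.
- by move=> y; apply: cvgB; [exact: cvg_cst|exact: cf].
- move=> y; have /f01 : range f (f y) by exists y.
  by rewrite /= in_itv /= subr_ge0 lerBlDr lerDl => /andP[-> ->].
- have -> : f x = 0 by apply: fx; exists x.
  by rewrite subr0.
- move=> y Cy; have -> : f y = 1 by apply: fC; exists y.
  by rewrite subrr.
Qed.

(** With |b| <= M, b is the join over x of the peaks equal to b(x) at x and to - M elsewhere. A peak
    is the meet of the continuous functions above it: the constant b(x) is exact at x, and at y <> x
    a Urysohn function rescaled to run from - M at y to b(x) at x is exact at y. *)
Lemma cont_incl_dense (b : linfty R X) : join_of_meets (cont_incl R cX) b.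
Proof.
have [M M0 bM] := linfty_bounded b.
have bM' x : - M <= fval b x by have := bM x; rewrite ler_norml => /andP[].
pose peak x : X -> R := fun y => if `[< y = x >] then fval b x else - M.
have peakx x : peak x x = fval b x by rewrite /peak asboolT.
have peaky x y : y <> x -> peak x y = - M by move=> yx; rewrite /peak asboolF.
exists [set d | exists x, fval d = peak x].
  move=> d [x dE].
  exists [set g | forall y, peak x y <= fval g y].
  apply/linfty_infP => y; rewrite dE; split=> [_ [g gp <-]//|c cg].
  move: cg; have [->|yx] := pselect (y = x) => cg.
    rewrite peakx; have [|g gE] := @cont_ex R X cX (fun=> fval b x).
      by move=> z; exact: cvg_cst.
    have <- : fval g x = fval b x by rewrite gE.
    apply: (cg (cont_incl R cX g)); exists g => //.
    move=> z; rewrite gE; have [->|/peaky ->//] := pselect (z = x).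
    by rewrite peakx.
  rewrite peaky //.
  have cly : closed [set y].
    by apply: accessible_closed_set1; exact: hausdorff_accessible.
  have [|f [cf f01 fx fy]] := @urysohn_point_closed x [set y] cly.
    by move=> xy; exact: yx.
  have [|g gE] := @cont_ex R X cX (fun z => (fval b x + M) * f z - M).
    move=> z; apply: cvgB; last exact: cvg_cst.
    by apply: cvgM; [exact: cvg_cst|exact: cf].
  have <- : fval g y = - M by rewrite gE fy // mulr0 sub0r.
  apply: (cg (cont_incl R cX g)); exists g => // z; rewrite gE.
  have [->|/peaky ->] := pselect (z = x); first by rewrite peakx fx mulr1 addrK.
  rewrite lerDr mulr_ge0 //; last by case/andP: (f01 z).
  by rewrite -lerBlDr sub0r.
apply/linfty_supP => x; split=> [d [y dy]|c hc].
  rewrite dy; have [->|/peaky ->//] := pselect (x = y).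
  by rewrite peakx.
have [|d dE] := @linfty_ex R X (peak x) M.
  by move=> y; rewrite /peak; case: ifP => _; rewrite ?normrN ?(ger0_norm M0).
by rewrite -peakx -dE; apply: hc; exists x.
Qed.

Definition cont_extension : basic_extension R :=
  BasicExtension (injective_monic (@cont_incl_inj R X cX)) (linfty_basic R X)
    cont_incl_dense.

Lemma cont_alg_norm_lt (f : cont_alg R cX) e x :
  bal_norm f < e -> `|fval f x| <= e.
Proof.
move=> /bal_norm_lt /fval_le/(_ x).
by rewrite !fvalE mulr1 ge_max ler_norml lerNl => /andP[-> ->].
Qed.

Lemma cont_alg_norm_le (f : cont_alg R cX) e : 0 <= e ->
  (forall x, `|fval f x| <= e) -> bal_norm f <= e.
Proof.
move=> e0 fe; apply: bal_norm_le => //; apply/fval_le => x.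
by rewrite !fvalE mulr1 ge_max lerNl andbC -ler_norml.
Qed.

Lemma cont_alg_complete : uniformly_complete (cont_alg R cX).
Proof.
move=> u cu.
have cux (e : R) x : 0 < e -> exists N, forall m n, (N <= m)%N -> (N <= n)%N ->
    `|fval (u m) x - fval (u n) x| <= e.
  move=> e0; have [N hN] := cu e e0; exists N => m n Nm Nn.
  exact: (@cont_alg_norm_lt (u m - u n)) (hN _ _ Nm Nn).
pose l x : R := lim (fval (u n) x @[n --> \oo]).
have ul x : fval (u n) x @[n --> \oo] --> l x.
  apply: cauchy_cvg; apply: cauchy_exP => e e0.
  have [N hN] := cux _ x (divr_gt0 e0 (ltr0n R 2)); exists (fval (u N) x).
  exists N => // n /= Nn; apply: le_lt_trans (hN N n (leqnn N) Nn) _.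
  by rewrite ltr_pdivrMr // ltr_pMr // ltr1n.
have lu (e : R) : 0 < e -> exists N, forall n, (N <= n)%N -> forall x,
    `|fval (u n) x - l x| <= e.
  move=> e0; have [N hN] := cu e e0; exists N => n Nn x.
  (* The Cauchy bound is uniform in x; the index needed to approach the limit depends on x, and
     enters only through the arbitrary error d. *)
  apply/ler_addgt0Pr => d d0.
  have /cvgrPdist_lt/(_ _ d0)[N' _ hN'] := ul x.
  have := hN' (maxn N N') (leq_maxr _ _); rewrite distrC => /ltW h1.
  have h2 := @cont_alg_norm_lt (u n - u (maxn N N')) e x (hN _ _ Nn (leq_maxl _ _)).
  rewrite -(subrKA (fval (u (maxn N N')) x)).
  exact: le_trans (ler_normD _ _) (lerD h2 h1).
have cl : continuous l.
  move=> x; apply/cvgrPdist_lt => e e0.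
  have e3 : 0 < e / 3 by rewrite divr_gt0.
  have [N hN] := lu _ e3; have lN := hN N (leqnn N).
  have /cvgrPdist_lt/(_ _ e3) := @fval_continuous R X cX (u N) x.
  apply: filterS => y /= xy.
  have -> : l x - l y = (fval (u N) y - l y) - (fval (u N) x - l x) +
      (fval (u N) x - fval (u N) y).
    by ring.
  have -> : e = e / 3 + e / 3 + e / 3 by field.
  apply: le_lt_trans (ler_normD _ _) _; apply: ler_ltD => //.
  by apply: le_trans (ler_normB _ _) _; exact: lerD.
have [f fE] := cont_ex cX cl; exists f => e e0.
have e2 : 0 < e / 2 by rewrite divr_gt0.
have [N hN] := lu _ e2; exists N => n Nn.
apply: (@le_lt_trans _ _ (e / 2)); last by rewrite ltr_pdivrMr // ltr_pMr // ltr1n.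
by apply: cont_alg_norm_le => [|x]; rewrite ?(ltW e2) // fvalD fvalN fE; exact: hN.
Qed.

(** Meets and joins being pointwise, the gap e, split into halves, gives at each x some s in S and t
    in T with s(x) < t(x). This persists on a neighbourhood of x, and finitely many such
    neighbourhoods cover X. *)
Lemma cont_incl_conditionC : conditionC (cont_incl R cX).
Proof.
move=> S T e i j e0 /linfty_infP infS /linfty_supP supT /fval_le ij.
have st x : exists p : cont_alg R cX * cont_alg R cX,
    [/\ S p.1, T p.2 & fval p.1 x < fval p.2 x].
  have e2 : 0 < e / 2 by rewrite divr_gt0.
  have [s Ss sx] : exists2 s, S s & fval s x < fval i x + e / 2.
    apply: contrapT => h; have [_ /(_ (fval i x + e / 2))] := infS x.
    rewrite gerDl leNgt e2 => hc; suff : ~~ true by [].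
    apply: hc => _ [s Ss <-].
    by rewrite leNgt; apply/negP => sx; apply: h; exists s.
  have [t Tt tx] : exists2 t, T t & fval j x - e / 2 < fval t x.
    apply: contrapT => h; have [_ /(_ (fval j x - e / 2))] := supT x.
    rewrite lerBrDr gerDl leNgt e2 => hc; suff : ~~ true by [].
    apply: hc => _ [t Tt <-].
    by rewrite leNgt; apply/negP => tx; apply: h; exists t.
  exists (s, t); split=> //=; apply: lt_trans sx _; apply: le_lt_trans tx.
  rewrite lerBrDr -addrA -splitr; have := ij x.
  by rewrite !fvalE mulr1.
have [p hp] := choice st.
have [|xs hxs] := @compact_finite_cover X
    (fun x => [set y | fval (p x).1 y < fval (p x).2 y]) cX.
  move=> x; have [_ _ px] := hp x.
  have /cvgrPdist_lt := @fval_continuous R X cX ((p x).2 - (p x).1) x.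
  rewrite fvalE => /(_ (fval (p x).2 x - fval (p x).1 x)).
  rewrite subr_gt0 => /(_ px); apply: filterS => y pxy.
  have /(le_lt_trans (ler_norm _)) : `|(fval (p x).2 x - fval (p x).1 x) -
    (fval (p x).2 y - fval (p x).1 y)| < fval (p x).2 x - fval (p x).1 x := pxy.
  by rewrite ltrBlDr ltrDl subr_gt0.
exists [set (p x).1 | x in [set` xs]], [set (p x).2 | x in [set` xs]]; split.
- by move=> _ [x _ <-]; have [] := hp x.
- exact/finite_image/finite_seq.
- by move=> _ [x _ <-]; have [] := hp x.
- exact/finite_image/finite_seq.
(* An empty list means that X is empty; then any two elements compare, and 0 is both the infimum and
   the supremum required. *)
have [[x xxs]|xs0] := pselect (exists x, x \in xs); last first.
  have X0 (x : X) : False by have [y yxs _] := hxs x; apply: xs0; exists y.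
  have A0 (f g : cont_alg R cX) : f <= g by apply/fval_le => x.
  by exists 0, 0; split => //; split=> f _ //=; exact: A0.
have [||s [sl su] _] := @finite_infimum _ (cont_alg R cX) setT
    [set (p x).1 | x in [set` xs]] (fun _ _ _ _ => I) _ _ (@subsetT _ _).
- exact/finite_image/finite_seq.
- by exists (p x).1, x.
have [||t [tu tl] _] := @finite_supremum _ (cont_alg R cX) setT
    [set (p x).2 | x in [set` xs]] (fun _ _ _ _ => I) _ _ (@subsetT _ _).
- exact/finite_image/finite_seq.
- by exists (p x).2, x.
exists s, t; split=> //; apply/fval_le => y; have [z zxs pz] := hxs y.
have /fval_le/(_ y) sz := sl _ (ex_intro2 _ _ z zxs erefl).
have /fval_le/(_ y) tz := tu _ (ex_intro2 _ _ z zxs erefl).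
exact: le_trans sz (le_trans (ltW pz) tz).
Qed.

Lemma cont_extension_compact : compact_extension cont_extension.
Proof. by split; [exact: cont_alg_complete|exact: cont_incl_conditionC]. Qed.

End CompactExtension.

(** * The contravariant functor *)

Section Pullback.
Variable R : realType.

Definition linfty_pullback (X Y : Type) (phi : Y -> X) :
    balHom (linfty R X) (linfty R Y) :=
  fun_pullback (bounded_funs_alg R X) (bounded_funs_alg R Y) (phi := phi)
    (fun f fM => let: ex_intro M h := fM in ex_intro _ M (fun y => h (phi y))).

Lemma linfty_pullbackE (X Y : Type) (phi : Y -> X) f y :
  fval (linfty_pullback phi f) y = fval f (phi y).
Proof. by []. Qed.

Lemma linfty_pullback_normal (X Y : Type) (phi : Y -> X) :
  normal (linfty_pullback phi).
Proof.
move=> S b /linfty_supP supS; apply/linfty_supP => y.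
have [ub lb] := supS (phi y); split=> [_ [f Sf <-]|c hc]; first exact: ub.
by apply: lb => f Sf; apply: (hc (linfty_pullback phi f)); exists f.
Qed.

(* The indicators of the points of X have join 1, so by normality exactly one of
   them is sent to 1 by evaluation at y. *)
Lemma linfty_normal_pullback (X Y : Type)
    (sigma : balHom (linfty R X) (linfty R Y)) :
  normal sigma -> exists phi : Y -> X,
    forall f y, fval (sigma f) y = fval f (phi y).
Proof.
move=> sN; have [delta deltaP] := choice (@linfty_delta R X).
have sup1 : supremums (range delta) (1 : linfty R X).
  apply/linfty_supP => x; have [dx dy] := deltaP x; split=> [_ [z _ <-]|c hc].
    have [dz dnz] := deltaP z; rewrite fval1.
    have [->|xz] := pselect (x = z); first by rewrite dz.
    by rewrite dnz // ler01.
  by rewrite fval1 -dx; apply: hc; exists x.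
(* Applying sigma to this identity and evaluating at y, where the indicator of phi(y) is sent to 1,
   yields the value f(phi(y)). *)
have delta_mul f x : f * delta x = fval f x *: delta x.
  apply: fval_ext => z; rewrite fvalM fvalZ; have [dx dy] := deltaP x.
  have [->//|zx] := pselect (z = x).
  by rewrite dy // !mulr0.
suff /choice[phi phiP] : forall y, exists x, fval (sigma (delta x)) y = 1.
  exists phi => f y.
  have := congr1 (fun k => fval (sigma k) y) (delta_mul f (phi y)).
  by rewrite rmorphM balHom_scale fvalM fvalZ phiP !mulr1.
move=> y; apply: contrapT => /forallNP h.
have /linfty_supP/(_ y)[_ /(_ 0)] := sN _ _ sup1.
rewrite rmorph1 fval1 ler10 => hc; suff : false by [].
apply: hc => _ [_ [x _ <-] <-].
have idx : is_idempotent (sigma (delta x)).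
  rewrite /is_idempotent -rmorphM delta_mul; have [-> _] := deltaP x.
  by rewrite scale1r.
by have [->|/h] := linfty_idempotent y idx.
Qed.

(** A Urysohn function that is 1 at phi(y) and 0 off U, pulled back, is within 1 of its value at y
    only at points sent into U. *)
Lemma cont_pullback_continuous (X Y : topologicalType) (cX : compact [set: X])
    (hX : hausdorff_space X) (phi : Y -> X) :
  (forall f : cont_alg R cX, continuous (fval f \o phi)) -> continuous phi.
Proof.
move=> cphi; apply/continuousP => U oU; rewrite openE => y Uy.
have [||f [cf f01 fx fU]] := @urysohn_point_closed R X cX hX (phi y) (~` U).
- exact: open_closedC.
- by apply.
have [g gE] := cont_ex cX cf; have := cphi g y.
have half : 0 < 1 :> R by [].
move=> /cvgrPdist_lt/(_ _ half); rewrite gE /= fx; apply: filterS => z /=.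
move=> fz; apply: contrapT => nUz; move: fz.
by rewrite fU // subr0 normr1 ltxx.
Qed.

Definition cont_pullback (X Y : topologicalType) (cX : compact [set: X])
    (cY : compact [set: Y]) (phi : continuousType Y X) :
    balHom (cont_alg R cX) (cont_alg R cY) :=
  fun_pullback (cont_funs_alg R cX) (cont_funs_alg R cY) (phi := phi)
    (fun f cf => fun y => continuous_comp (@cts_fun _ _ phi y) (cf (phi y))).

End Pullback.

Section ContinuousFunctor.
Variable R : realType.

Definition cont_obj (X : op_category KHaus) : cbasic R :=
  exist _ (cont_extension R (svalP X).1 (svalP X).2)
    (cont_extension_compact R (svalP X).1 (svalP X).2).

Definition cont_hom (X Y : op_category KHaus) (phi : hom X Y) :
  hom (cont_obj X) (cont_obj Y).
Proof.
apply: (@BasicHom _ (sval (cont_obj X)) (sval (cont_obj Y))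
  (cont_pullback R (svalP X).1 (svalP Y).1 phi) (linfty_pullback R phi)).
- exact: linfty_pullback_normal.
- by apply: balHom_ext => f; apply: fval_ext.
Defined.

Lemma cont_hom1 X : cont_hom (idm X) = idm (cont_obj X).
Proof. by apply: basic_hom_ext; apply: balHom_ext => f; apply: fval_ext. Qed.

Lemma cont_homM X Y Z (g : hom Y Z) (f : hom X Y) :
  cont_hom (comp g f) = comp (cont_hom g) (cont_hom f).
Proof. by apply: basic_hom_ext; apply: balHom_ext => h; apply: fval_ext. Qed.

Definition cont_functor : functor (op_category KHaus) (cbasic R) :=
  Functor cont_hom1 cont_homM.

(** The map on bounded functions determines the map on points: the indicator of phi(y) detects
    psi(y). *)
Lemma cont_functor_faithful X Y : injective (@fmap _ _ cont_functor X Y).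
Proof.
move=> phi psi /(congr1 (fun k : basic_hom _ _ => hom_cod k)) e.
apply/continuousEP => y.
have [d [d1 d0]] := @linfty_delta R (sval X) (phi y).
have /(congr1 (fun k : linfty R (sval Y) => fval k y)) :=
  congr1 (fun k : balHom (linfty R (sval X)) (linfty R (sval Y)) => k d) e.
rewrite !linfty_pullbackE d1 => d2; apply: contrapT => ne.
move: d2; rewrite d0; first by move/eqP; rewrite oner_eq0.
by move=> h; apply: ne.
Qed.

(** The normal component yields phi as a map of sets; commutation with the inclusions shows that g
    composed with phi is the image of g under the other component, hence continuous. *)
Lemma cont_functor_full X Y (f : hom (cont_functor X) (cont_functor Y)) :
  exists phi : hom X Y, fmap cont_functor phi = f.
Proof.
have [phi phiP] := linfty_normal_pullback (@hom_normal _ _ _ f).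
have rhoP g y : fval (hom_dom f g) y = fval g (phi y).
  have /(congr1 (fun k : linfty R (sval Y) => fval k y)) :=
    congr1 (fun k : balHom (ext_dom (sval (cont_functor X)))
      (linfty R (sval Y)) => k g) (hom_commute f).
  by move=> h; exact: etrans (esym h) (phiP _ _).
have cphi : continuous phi.
  apply: (cont_pullback_continuous (cX := (svalP X).1)) => [|g].
    exact: (svalP X).2.
  have -> : fval g \o phi = fval (hom_dom f g).
    by apply/funext => y; rewrite /= rhoP.
  exact: fval_continuous.
exists (mkcts cphi : continuousType _ _); apply: basic_hom_ext;
  apply: balHom_ext => g; apply: fval_ext => y.
- by rewrite rhoP.
- by rewrite phiP.
Qed.

End ContinuousFunctor.

(** * Fully faithful, essentially surjective functors *)

Section FullyFaithfulEquivalence.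
Variables (C D : category) (G : functor D C).
Hypothesis G_faithful : forall x y : D, injective (@fmap _ _ G x y).
Hypothesis G_full : forall (x y : D) (f : hom (G x) (G y)),
  exists g : hom x y, fmap G g = f.
Hypothesis G_surj : forall c : C, exists (d : D) (f : hom (G d) c), is_iso f.

(** Object and both arrows are packed together, so that a single choice produces [F], [i] and [j]
    coherently. *)
Let iso_pair (c : C) : exists p : {d : D & (hom (G d) c * hom c (G d))%type},
  comp (projT2 p).1 (projT2 p).2 = idm c /\
  comp (projT2 p).2 (projT2 p).1 = idm (G (projT1 p)).
Proof. by have [d [f [g [gf fg]]]] := G_surj c; exists (existT _ d (f, g)). Qed.

Let F (c : C) : D := projT1 (sval (cid (iso_pair c))).
Let i (c : C) : hom (G (F c)) c := (projT2 (sval (cid (iso_pair c)))).1.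
Let j (c : C) : hom c (G (F c)) := (projT2 (sval (cid (iso_pair c)))).2.

Let ij c : comp (i c) (j c) = idm c.
Proof. exact: (svalP (cid (iso_pair c))).1. Qed.

Let ji c : comp (j c) (i c) = idm (G (F c)).
Proof. exact: (svalP (cid (iso_pair c))).2. Qed.

Let lift (x y : D) (f : hom (G x) (G y)) : hom x y := sval (cid (G_full f)).

Let liftE x y (f : hom (G x) (G y)) : fmap G (lift f) = f.
Proof. exact: svalP (cid (G_full f)). Qed.

Let F_hom (x y : C) (f : hom x y) : hom (F x) (F y) :=
  lift (comp (j y) (comp f (i x))).

Let F_hom1 x : F_hom (idm x) = idm (F x).
Proof. by apply: G_faithful; rewrite liftE comp1f ji fmap1. Qed.

Let F_homM x y z (g : hom y z) (f : hom x y) :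
  F_hom (comp g f) = comp (F_hom g) (F_hom f).
Proof.
apply: G_faithful; rewrite fmapM !liftE -!compA; congr (comp _ (comp _ _)).
by rewrite compA ij comp1f.
Qed.

(** Conjugation by [i] and [j] in [F_hom] makes [i] natural; on D the isomorphism is the lift of
    [i (G d)], and its laws are checked after applying the faithful G. *)
Lemma fully_faithful_equivalent : equivalent C D.
Proof.
exists (Functor F_hom1 F_homM), G; split.
  exists i; split=> [c|x y f] /=; first by exists (j c); rewrite ij ji.
  by rewrite liftE compA ij comp1f.
exists (fun d => lift (i (G d))); split=> [d|x y f] /=.
  by exists (lift (j (G d))); split; apply: G_faithful;
    rewrite fmapM !liftE ?ij ?ji fmap1.
by apply: G_faithful; rewrite !fmapM !liftE compA ij comp1f.
Qed.

End FullyFaithfulEquivalence.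

(** * The space of atoms of a compact basic extension *)

Section AtomRepresentation.
Variables (R : realType) (B : balType R).
Hypothesis basicB : basic_algebra B.

Definition atoms : Type := {e : B | is_idempotent_atom e}.

Implicit Types (x y : atoms) (a b : B) (r : R).

Let dcB : dedekind_complete B := basicB.1.

Definition atom_val x b : R := sval (cid (atom_eigen dcB (svalP x) b)).

Lemma atom_valP x b : sval x * b = atom_val x b *: sval x.
Proof. exact: svalP (cid (atom_eigen dcB (svalP x) b)). Qed.

Lemma atom_val_eq x b r : sval x * b = r *: sval x -> atom_val x b = r.
Proof. by rewrite atom_valP => /(atom_scale_inj (svalP x)). Qed.

Lemma atom_valB x : {morph atom_val x : a b / a - b}.
Proof. by move=> a b; apply: atom_val_eq; rewrite mulrBr !atom_valP scalerBl. Qed.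

Lemma atom_valD x : {morph atom_val x : a b / a + b}.
Proof. by move=> a b; apply: atom_val_eq; rewrite mulrDr !atom_valP scalerDl. Qed.

Lemma atom_val1 x : atom_val x 1 = 1.
Proof. by apply: atom_val_eq; rewrite mulr1 scale1r. Qed.

Lemma atom_val0 x : atom_val x 0 = 0.
Proof. by apply: atom_val_eq; rewrite mulr0 scale0r. Qed.

Lemma atom_valZ x r b : atom_val x (r *: b) = r * atom_val x b.
Proof. by apply: atom_val_eq; rewrite -bal_scaleAr atom_valP scalerA. Qed.

Lemma atom_valM x : {morph atom_val x : a b / a * b}.
Proof.
move=> a b; apply: atom_val_eq.
by rewrite mulrA atom_valP -bal_scaleAl atom_valP scalerA.
Qed.

Lemma atom_val_ge0 x b : 0 <= b -> 0 <= atom_val x b.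
Proof.
move=> b0; rewrite -(atom_scale_le (svalP x)) scale0r -atom_valP.
exact: lring_mulr_ge0 (atom_ge0 (svalP x)) b0.
Qed.

Lemma atom_val_le x a b : a <= b -> atom_val x a <= atom_val x b.
Proof.
by rewrite -lr_subge0 => /(atom_val_ge0 x); rewrite atom_valB subr_ge0.
Qed.

(** The values of the positive and negative parts have product 0 in R, so one vanishes. *)
Lemma atom_val_pos_part x b : atom_val x (pos_part b) = Num.max (atom_val x b) 0.
Proof.
have p0 := atom_val_ge0 x (pos_part_ge0 b).
have q0 := atom_val_ge0 x (pos_part_ge0 (- b)).
have pq := bal_disj_mul (pos_part_ge0 b) (pos_part_ge0 (- b)) (pos_part_disj b).
have /eqP := congr1 (atom_val x) pq; rewrite atom_valM atom_val0 mulf_eq0.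
rewrite [in RHS](pos_part_decomp b) atom_valB.
move=> /orP[] /eqP h; rewrite h; first by rewrite sub0r max_r // oppr_le0.
by rewrite subr0 max_l.
Qed.

Lemma atom_val_join x a b :
  atom_val x (join a b) = Num.max (atom_val x a) (atom_val x b).
Proof.
rewrite lr_joinE atom_valD atom_val_pos_part atom_valB.
case: (leP (atom_val x b - atom_val x a) 0);
  by case: (leP (atom_val x a) (atom_val x b)); lra.
Qed.

(** Let p be the positive part of a - b and u the largest component disjoint from p. All atoms
    annihilate p; one below 1 - u would therefore also lie below u, which is absurd. By atomicity u
    = 1, and p, being bounded, is disjoint from itself up to a scalar, hence 0. *)
Lemma atom_val_sep a b : (forall x, atom_val x a <= atom_val x b) -> a <= b.
Proof.
move=> ab; rewrite -lr_subge0 -lr_leN2E oppr0 opprB; set d := a - b.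
apply: le_trans (pos_part_ge d) _; set p := pos_part d.
have p0 : 0 <= p := pos_part_ge0 d.
have [u [cu up hu]] := pseudo_complement dcB p0.
have [u1|u1] := pselect (1 - u = 0).
  have {}u1 : u = 1 by apply/eqP; rewrite eq_sym -subr_eq0 u1.
  rewrite u1 in up; have [r [r0 pr _]] := bal_bound p.
  have <- : meet p (r *: (1 : B)) = p by apply/meet_l.
  by apply: bal_disj_scale => //; rewrite ?bal_ler01 // meetC.
have cu' := component_compl cu.
have [e ae eu] := basicB.2 _ ((component_idempotent (1 - u)).1 cu') u1.
have ce := atom_component ae.
have {}eu : e <= 1 - u by apply/component_idempotent_le.
have ep : e * p = 0.
  have -> : e = sval (exist _ e ae : atoms) by [].
  rewrite atom_valP atom_val_pos_part max_r ?scale0r //.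
  by rewrite atom_valB subr_le0.
case: (atom_neq0 ae); apply/le_anti; rewrite (component_ge0 ce) andbT.
rewrite -cu lexI eu andbT.
apply: hu; [exact: component_ge0|exact: component_le1|].
exact/component_disj.
Qed.

Lemma atom_val_self x : atom_val x (sval x) = 1.
Proof.
apply: atom_val_eq; rewrite scale1r.
exact/component_idempotent/atom_component/svalP.
Qed.

Lemma atom_val_other x y : x <> y -> atom_val x (sval y) = 0.
Proof.
move=> xy; have [cx cy] := (atom_component (svalP x), atom_component (svalP y)).
have y0 := component_ge0 cy; apply: atom_val_eq; rewrite scale0r.
apply/component_disj => //; have [//|le_xy] := atom_meet (svalP x) cy.
case: xy; have [_ _ /(_ (sval x))] := svalP y; case.
- by have [] := svalP x.
- exact/component_idempotent_le.
- by move=> x0; case: (atom_neq0 (svalP x)).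
- by case: (x) (y) => [e pe] [e' pe'] /= ee'; exact: eq_exist.
Qed.

Lemma atom_val_bounded b : bounded_funs (atom_val ^~ b : atoms -> real_bal R).
Proof.
have [r [r0 br bNr]] := bal_bound b; exists r => x.
have hr c : c <= r *: (1 : B) -> atom_val x c <= r.
  by move=> /(atom_val_le x); rewrite atom_valZ atom_val1 mulr1.
rewrite ler_norml hr // andbT lerNl; move/hr : bNr.
by rewrite -[- b]sub0r atom_valB atom_val0 sub0r.
Qed.

Definition atom_rep_fun b : linfty R atoms := exist _ _ (atom_val_bounded b).

Definition atom_rep : balHom B (linfty R atoms).
Proof.
apply: (@mk_balHom _ _ _ atom_rep_fun) => [a b||a b|r a|a b];
  apply: fval_ext => x; rewrite ?fvalE.
- exact: atom_valB.
- exact: atom_val1.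
- exact: atom_valM.
- exact: atom_valZ.
- exact: atom_val_join.
Defined.

Lemma atom_repE b x : fval (atom_rep b) x = atom_val x b.
Proof. by []. Qed.

Lemma atom_rep_inj : injective atom_rep.
Proof.
move=> a b ab; have abx x : atom_val x a = atom_val x b by rewrite -!atom_repE ab.
by apply/le_anti/andP; split; apply: atom_val_sep => x; rewrite abx.
Qed.

(** The preimage b is the join of the f(x) e_x. It does not exceed f at x, since b lowered to f(x)
    at x alone is still an upper bound. Adding 0 to the family keeps it nonempty when there are no
    atoms. *)
Lemma atom_rep_surj_ge0 (f : linfty R atoms) : 0 <= f -> exists b, atom_rep b = f.
Proof.
move=> /fval_le f0; have [M M0 fM] := linfty_bounded f.
pose S := [set b : B | b = 0 \/ exists x, b = fval f x *: sval x].
have [||b [ubS lbS]] := dcB (S := S).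
- by exists 0; left.
- exists (M *: (1 : B)) => _ [->|[x ->]].
    exact: bal_scaler_ge0 M0 (bal_ler01 B).
  apply: (@le_trans _ _ (M *: sval x)).
    by apply: bal_ler_wZr (atom_ge0 (svalP x)) (le_trans (ler_norm _) (fM x)).
  by apply: bal_ler_pZl M0 (component_le1 (atom_component (svalP x))).
have b0 : 0 <= b by apply: ubS; left.
exists b; apply: fval_ext => x; rewrite atom_repE; apply/le_anti/andP; split.
  pose c := b - (atom_val x b - fval f x) *: sval x.
  have cx : atom_val x c = fval f x.
    by rewrite atom_valB atom_valZ atom_val_self mulr1 subKr.
  have cy y : y <> x -> atom_val y c = atom_val y b.
    by move=> yx; rewrite atom_valB atom_valZ atom_val_other // mulr0 subr0.
  rewrite -cx; apply/atom_val_le/lbS => _ [->|[z ->]]; apply: atom_val_sep => y.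
    rewrite atom_val0; have [->|/cy ->] := pselect (y = x); first by rewrite cx f0.
    exact: atom_val_ge0.
  have [->|yx] := pselect (y = x).
    rewrite cx atom_valZ; have [->|xz] := pselect (x = z).
      by rewrite atom_val_self mulr1.
    by rewrite atom_val_other // mulr0 f0.
  by rewrite cy //; apply/atom_val_le/ubS; right; exists z.
have -> : fval f x = atom_val x (fval f x *: sval x).
  by rewrite atom_valZ atom_val_self mulr1.
by apply/atom_val_le/ubS; right; exists x.
Qed.

Lemma atom_rep_surj (f : linfty R atoms) : exists b, atom_rep b = f.
Proof.
have [b bf] := atom_rep_surj_ge0 (pos_part_ge0 f).
have [c cf] := atom_rep_surj_ge0 (pos_part_ge0 (- f)).
by exists (b - c); rewrite rmorphB bf cf -pos_part_decomp.
Qed.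

Lemma atom_rep_leE a b : (atom_rep a <= atom_rep b) = (a <= b).
Proof. exact: balHom_leE atom_rep_inj. Qed.

End AtomRepresentation.

(** * The topology on the atoms and the Gelfand representation *)

Section Spectrum.
Variables (R : realType) (alpha : basic_extension R).

Local Notation A := (ext_dom alpha).
Local Notation B := (ext_cod alpha).

(** A separate name for the atoms, since the topology depends on [alpha] and not only on B. *)
Definition spectrum : Type := atoms B.

Definition gelfand : balHom A (linfty R spectrum) :=
  bal_comp (atom_rep (ext_basic alpha)) alpha.

Local Notation gv a := (fval (gelfand a)).

Definition gelfandE := (rmorph0 gelfand, rmorph1 gelfand, rmorphN gelfand,
  rmorphD gelfand, balHom_scale gelfand, balHom_meet gelfand,
  balHom_join gelfand, fvalE (bounded_funs_alg R spectrum)).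

Lemma gelfand_inj : injective gelfand.
Proof.
by move=> a b /atom_rep_inj; exact: monic_injective (@ext_monic _ alpha) _ _.
Qed.

Lemma gelfand_le a b : a <= b <-> forall x, gv a x <= gv b x.
Proof. by rewrite -(balHom_leE _ _ gelfand_inj) fval_le. Qed.

Definition spectrum_nbhs (x : spectrum) : set_system spectrum :=
  [set U | exists2 a, 0 < gv a x & [set y | 0 < gv a y] `<=` U].

HB.instance Definition _ := gen_eqMixin spectrum.
HB.instance Definition _ := gen_choiceMixin spectrum.
HB.instance Definition _ := hasNbhs.Build spectrum spectrum_nbhs.

Lemma spectrum_nbhs_filter (x : spectrum) : ProperFilter (nbhs x).
Proof.
split=> [[a ax /(_ x)]|]; first exact.
split.
- by exists 1; rewrite // !gelfandE.
- move=> U V [a ax aU] [b bx bV]; exists (meet a b).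
    by rewrite !gelfandE lt_min ax.
  move=> y; rewrite /mkset !gelfandE lt_min => /andP[ay b_y].
  by split; [exact: aU|exact: bV].
- by move=> U V UV [a ax aU]; exists a => // y /aU/UV.
Qed.

Lemma spectrum_nbhs_singleton (x : spectrum) (U : set spectrum) :
  nbhs x U -> U x.
Proof. by move=> [a ax]; exact. Qed.

Lemma spectrum_nbhs_nbhs (x : spectrum) (U : set spectrum) :
  nbhs x U -> nbhs x (nbhs^~ U).
Proof. by move=> [a ax aU]; exists a => // y ay; exists a. Qed.

HB.instance Definition _ := Nbhs_isNbhsTopological.Build spectrum
  spectrum_nbhs_filter spectrum_nbhs_singleton spectrum_nbhs_nbhs.

Lemma gelfand_continuous a : continuous (gv a : spectrum -> R).
Proof.
have dist (p q e : R) : (0 < e + p - q) && (0 < e - p + q) -> `|p - q| < e.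
  by rewrite ltr_norml => /andP[h1 h2]; apply/andP; split; lra.
move=> x; apply/(@cvgrPdist_lt _ _ _ (nbhs x) (nbhs_filter x)) => e e0.
pose r := gv a x.
(* This element is positive at y exactly when the value of a at y is within e of r. *)
exists (meet ((e + r) *: (1 : A) - a) ((e - r) *: (1 : A) + a)).
  by rewrite !gelfandE !mulr1 /r addrK subrK minxx.
move=> y; rewrite /mkset !gelfandE !mulr1 lt_min.
exact: dist.
Qed.

Lemma atom_rep_infimums (S : set B) b :
  infimums (atom_rep (ext_basic alpha) @` S) (atom_rep (ext_basic alpha) b) <->
  infimums S b.
Proof.
split=> -[lb ub]; split.
- by move=> s Ss; rewrite -(atom_rep_leE (ext_basic alpha)); apply: lb; exists s.
- move=> c hc; rewrite -(atom_rep_leE (ext_basic alpha)); apply: ub => _ [s Ss <-].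
  exact/balHom_le/hc.
- by move=> _ [s Ss <-]; exact/balHom_le/lb.
- move=> f hf; have [c cf] := atom_rep_surj (ext_basic alpha) f.
  rewrite -cf in hf *; apply/balHom_le/ub => s Ss.
  by rewrite -(atom_rep_leE (ext_basic alpha)); apply: hf; exists s.
Qed.

Lemma atom_rep_supremums (S : set B) b :
  supremums (atom_rep (ext_basic alpha) @` S) (atom_rep (ext_basic alpha) b) <->
  supremums S b.
Proof.
split=> -[lb ub]; split.
- by move=> s Ss; rewrite -(atom_rep_leE (ext_basic alpha)); apply: lb; exists s.
- move=> c hc; rewrite -(atom_rep_leE (ext_basic alpha)); apply: ub => _ [s Ss <-].
  exact/balHom_le/hc.
- by move=> _ [s Ss <-]; exact/balHom_le/lb.
- move=> f hf; have [c cf] := atom_rep_surj (ext_basic alpha) f.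
  rewrite -cf in hf *; apply/balHom_le/ub => s Ss.
  by rewrite -(atom_rep_leE (ext_basic alpha)); apply: hf; exists s.
Qed.

(** Elements of B being pointwise joins of meets of elements of A, equal values on A force b(x) <=
    b(y) for all b in B. The atom x itself has value 1 at x and 0 at any other point. *)
Lemma gelfand_separates (x y : spectrum) :
  (forall a, gv a x = gv a y) -> x = y.
Proof.
move=> axy; apply: contrapT => xy.
pose w b := fval (atom_rep (ext_basic alpha) b).
suff : forall b, w b x <= w b y.
  move=> /(_ (sval x)); rewrite /w !atom_repE atom_val_self atom_val_other ?ler10 //.
  by move=> yx; apply: xy.
move=> b; have [D DE /atom_rep_supremums/linfty_supP supD] := ext_dense b.
have [_] := supD x; apply=> _ [d Dd <-].
have [S /atom_rep_infimums/linfty_infP infS] := DE d Dd.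
apply: (@le_trans _ _ (w d y)); last by have [+ _] := supD y; apply; exists d.
have [_] := infS y; apply=> _ [_ [a Sa <-] <-].
rewrite -[leRHS]/(gv a y) -axy.
have [+ _] := infS x; apply; by exists (alpha a).
Qed.

Lemma spectrum_hausdorff : hausdorff_space spectrum.
Proof.
move=> x y xy; apply: gelfand_separates => a.
apply: (@Rhausdorff R) => U V /gelfand_continuous nU /gelfand_continuous nV.
by have [z [zU zV]] := xy _ _ nU nV; exists (gv a z).
Qed.

Hypothesis compact_alpha : compact_extension alpha.

Lemma gelfand_conditionC : conditionC gelfand.
Proof.
move=> S T e i j e0 infS supT ij.
have [b bi] := atom_rep_surj (ext_basic alpha) i.
have [c cj] := atom_rep_surj (ext_basic alpha) j.
apply: (@compact_alpha.2 S T e b c) => //.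
- by apply/atom_rep_infimums; rewrite bi image_comp.
- by apply/atom_rep_supremums; rewrite cj image_comp.
- rewrite -(atom_rep_leE (ext_basic alpha)) rmorphD balHom_scale rmorph1.
  by rewrite bi cj.
Qed.

Lemma linfty_const (r : R) (x : spectrum) :
  fval (r *: (1 : linfty R spectrum)) x = r.
Proof. by rewrite fvalZ fval1 mulr1. Qed.

Lemma gelfand_const (r : R) (x : spectrum) : gv (r *: (1 : A)) x = r.
Proof. by rewrite !gelfandE mulr1. Qed.

(** If F has no cluster point, each x has some a with a(x) > 0 that is F-eventually <= 0. Such
    elements below 1 form a join-stable set T with pointwise join 1. By (C) with 1/2 on the left, a
    finite join from T is at least 1/2 everywhere, although it is F-eventually <= 0. *)
Lemma spectrum_compact : compact [set: spectrum].
Proof.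
move=> F PF _; apply: contrapT => ncl.
have sep x : exists2 a, 0 < gv a x & F [set y | gv a y <= 0].
  apply: contrapT => h; apply: ncl; exists x; split=> // U V FU [a ax aV].
  apply: contrapT => UV; apply: h; exists a => //.
  apply: filterS FU => y Uy; rewrite /mkset leNgt; apply/negP => ay.
  by apply: UV; exists y; split=> //; exact: aV.
pose T := [set a | F [set y | gv a y <= 0] /\ a <= 1].
have T_join a b : T a -> T b -> T (join a b).
  move=> [Fa a1] [Fb b1]; split; last by rewrite leUx a1.
  apply: filterS (filterI Fa Fb) => y [ay b_y].
  by rewrite /mkset !gelfandE ge_max ay.
have infS : infimums (gelfand @` [set 2^-1 *: (1 : A)])
    (2^-1 *: (1 : linfty R spectrum)).
  apply/linfty_infP => x; rewrite linfty_const.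
  split=> [_ [_ -> <-]|c hc]; first by rewrite gelfand_const.
  by rewrite -(gelfand_const 2^-1 x); apply: hc; exists (2^-1 *: (1 : A)).
have supT : supremums (gelfand @` T) (1 : linfty R spectrum).
  apply/linfty_supP => x; split=> [_ [a [_ a1] <-]|c hc].
    by have /gelfand_le/(_ x) := a1; rewrite rmorph1.
  have [a ax Fa] := sep x.
  (* Rescaling a to value 1 at x and truncating at 1 stays in T and reaches the bound at x. *)
  have -> : fval (1 : linfty R spectrum) x = gv (meet ((gv a x)^-1 *: a) 1) x.
    by rewrite !gelfandE mulVf ?minxx // gt_eqF.
  apply: hc; exists (meet ((gv a x)^-1 *: a) 1) => //; split; last exact: leIr.
  apply: filterS Fa => y; rewrite /mkset !gelfandE => ay.
  by rewrite ge_min mulr_ge0_le0 // invr_ge0 ltW.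
have h2 : (0 : R) < 2^-1 by rewrite invr_gt0.
have [|S' [T' [S'S _ T'T fT' [s [t [[_ ubs] tsup st]]]]]] :=
  gelfand_conditionC h2 infS supT.
  have e1 : 2^-1 + 2^-1 = 1 :> R by field.
  by rewrite -scalerDl e1 scale1r.
have st2 : 2^-1 *: (1 : A) <= t.
  by apply: le_trans st; apply: ubs => a /S'S ->.
have tx x : 2^-1 <= gv t x.
  by have /gelfand_le/(_ x) := st2; rewrite gelfand_const.
(* If T' is empty, t is a least element, so t <= 0; a point where this contradicts t >= 1/2 exists
   because F is proper. *)
have [T'0|T'0] := pselect (T' !=set0); last first.
  have [x _] := filter_ex (@filterT _ F _).
  have /gelfand_le/(_ x) : t <= 0.
    by apply: tsup.2 => a T'a; case: T'0; exists a.
  rewrite !gelfandE => tx0; have := le_trans (tx x) tx0.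
  by rewrite leNgt h2.
have [t' t'sup [Ft' _]] := finite_supremum T_join fT' T'0 T'T.
have tt' : t' = t by apply: is_subset1_supremums t'sup tsup.
have [x /=] := filter_ex Ft'.
by rewrite tt' => tx0; have := le_trans (tx x) tx0; rewrite leNgt h2.
Qed.

(* With |h| <= M, a(x) > 0 and h < h(x) + e on {a > 0}, the element
   h(x) + e + 2M (1 - a / a(x))^+ of A lies above h and has value h(x) + e at x. *)
Lemma gelfand_infimums (h : linfty R spectrum) :
  continuous (fval h : spectrum -> R) ->
  infimums (gelfand @` [set a | h <= gelfand a]) h.
Proof.
move=> ch; apply/linfty_infP => x; split=> [_ [a + <-]|c hc]; first by move/fval_le.
apply/ler_addgt0Pr => e e0; have [M M0 hM] := linfty_bounded h.
have [a ax ahx] : nbhs x [set y | fval h y < fval h x + e].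
  have /(@cvgrPdist_lt _ _ _ (nbhs x) (nbhs_filter x))/(_ _ e0) := ch x.
  apply: filterS => y; rewrite /mkset distrC => /(le_lt_trans (ler_norm _)).
  by rewrite ltrBlDl.
pose b := (fval h x + e) *: (1 : A) +
  (2 * M) *: pos_part (1 - (gv a x)^-1 *: a).
have bE y : gv b y = fval h x + e +
    2 * M * Num.max (1 - (gv a x)^-1 * gv a y) 0.
  by rewrite /b /pos_part !gelfandE mulr1.
have -> : fval h x + e = gv b x.
  by rewrite bE mulVf ?gt_eqF // subrr maxxx mulr0 addr0.
apply: hc; exists b => //; apply/fval_le => y; rewrite bE.
have M2 : 0 <= 2 * M by rewrite mulr_ge0.
have [ay|ay] := ltP 0 (gv a y).
  apply: le_trans (ltW (ahx y ay)) _; rewrite lerDl mulr_ge0 //.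
  by rewrite le_max lexx orbT.
have m1 : 1 <= Num.max (1 - (gv a x)^-1 * gv a y) 0.
  by rewrite le_max lerBrDl gerDr mulr_ge0_le0 // invr_ge0 ltW.
apply: (@le_trans _ _ (fval h x + e + 2 * M)); last first.
  by rewrite lerD2l ler_peMr.
have := hM x; have := hM y; rewrite !ler_norml => /andP[_ h1] /andP[h2 _].
by move: e0 h1 h2; lra.
Qed.

Lemma gelfand_supremums (h : linfty R spectrum) :
  continuous (fval h : spectrum -> R) ->
  supremums (gelfand @` [set a | gelfand a <= h]) h.
Proof.
move=> ch; have chN : continuous (fval (- h) : spectrum -> R).
  by move=> x; exact: cvgN (ch x).
have /linfty_infP infh := gelfand_infimums chN.
apply/linfty_supP => x; split=> [_ [a + <-]|c hc]; first by move/fval_le.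
rewrite -lerN2 -fvalN; apply: (infh x).2 => _ [a ha <-].
rewrite lerNl -fvalN -rmorphN; apply: hc; exists (- a) => //.
by rewrite /mkset rmorphN lr_leNl.
Qed.

Lemma gelfand_approx (h : linfty R spectrum) (e : R) : 0 < e ->
  continuous (fval h : spectrum -> R) ->
  exists a, h <= gelfand a /\ gelfand a <= h + e *: (1 : linfty R spectrum).
Proof.
move=> e0 ch; pose k := h + e *: (1 : linfty R spectrum).
have ck : continuous (fval k : spectrum -> R).
  have -> : fval k = (fun x => fval h x + e).
    by apply/funext => x; rewrite fvalD linfty_const.
  by move=> x; exact: cvgD (ch x) (cvg_cst e).
have [M M0 hM] := linfty_bounded h.
have infh := gelfand_infimums ch; have supk := gelfand_supremums ck.
have [S' [T' [S'S fS' T'T fT' [s [t [sinf tsup st]]]]]] :=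
  gelfand_conditionC e0 infh supk (lexx _).
exists s; split.
  (* If S' is empty, s is a greatest element and exceeds the bound M of h; dually, an empty T' makes
     t at most - M. *)
  have [S'0|S'0] := pselect (S' !=set0).
    have [|s' s'inf hs'] :=
      finite_infimum (T := [set a | h <= gelfand a]) _ fS' S'0 S'S.
      by move=> a b ha hb; rewrite /mkset balHom_meet lexI ha.
    by have -> : s = s' by apply: is_subset1_infimums sinf s'inf.
  have : M *: (1 : A) <= s by apply: sinf.2 => a S'a; case: S'0; exists a.
  move=> /(balHom_le gelfand); apply: le_trans; apply/fval_le => x.
  by rewrite gelfand_const; exact: le_trans (ler_norm _) (hM x).
apply: le_trans (balHom_le gelfand st) _.
have [T'0|T'0] := pselect (T' !=set0).
  have [|t' t'sup ht'] :=
    finite_supremum (T := [set a | gelfand a <= k]) _ fT' T'0 T'T.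
    by move=> a b ha hb; rewrite /mkset balHom_join leUx ha.
  by have -> : t = t' by apply: is_subset1_supremums tsup t'sup.
have : t <= - M *: (1 : A) by apply: tsup.2 => a T'a; case: T'0; exists a.
move=> /(balHom_le gelfand) /le_trans; apply; apply/fval_le => x.
rewrite gelfand_const fvalD linfty_const; have := hM x.
by rewrite ler_norml => /andP[h1 _]; move: e0 h1; lra.
Qed.

Lemma gelfand_surj (h : linfty R spectrum) :
  continuous (fval h : spectrum -> R) -> exists a, gelfand a = h.
Proof.
move=> ch.
have /choice[u uP] (n : nat) : exists a, forall x,
    `|fval h x - gv a x| <= n.+1%:R^-1.
  have n0 : 0 < n.+1%:R^-1 :> R by rewrite invr_gt0.
  have [a [/fval_le ha /fval_le ah]] := gelfand_approx n0 ch; exists a => x.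
  have := ah x; rewrite fvalD linfty_const distrC => ahx.
  by rewrite ger0_norm ?subr_ge0 // lerBlDl.
have inv_small (e : R) : 0 < e -> exists N : nat, forall n : nat, (N <= n)%N ->
    n.+1%:R^-1 <= e.
  move=> e0; exists (Num.truncn e^-1) => n Nn.
  rewrite -[leRHS]invrK lef_pV2 ?posrE ?invr_gt0 // ltW //.
  by apply: lt_le_trans (truncnS_gt _) _; rewrite ler_nat.
have [e e0|l ul] := compact_alpha.1 u.
  (* Two errors of e / 4 give a norm at most e / 2, which leaves room for the strict inequality. *)
  have [N hN] := inv_small (e / 4) (divr_gt0 e0 (ltr0n R 4)).
  exists N => m n Nm Nn; apply: (@le_lt_trans _ _ (e / 2)); last first.
    by rewrite ltr_pdivrMr // ltr_pMr // ltr1n.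
  have e2 : 0 <= e / 2 by rewrite ltW // divr_gt0.
  apply: bal_norm_le => //; apply/gelfand_le => x.
  rewrite gelfand_const !gelfandE ge_max lerNl andbC -ler_norml.
  have hm := le_trans (uP m x) (hN m Nm); have hn := le_trans (uP n x) (hN n Nn).
  rewrite -(subrKA (fval h x)); apply: le_trans (ler_normD _ _) _.
  rewrite [`|gv (u m) x - _|]distrC.
  have -> : e / 2 = e / 4 + e / 4 by field.
  exact: lerD.
exists l; apply: fval_ext => x; apply/eqP; rewrite -subr_eq0 -normr_le0.
apply/ler_addgt0Pr => e e0; rewrite add0r.
have e2 : 0 < e / 2 by rewrite divr_gt0.
have [N hN] := ul _ e2; have [N' hN'] := inv_small _ e2.
have h1 := hN _ (leq_maxl N N'); set n := maxn N N' in h1.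
have h2 := le_trans (uP n x) (hN' n (leq_maxr N N')).
have /gelfand_le/(_ x) := bal_norm_lt h1.
rewrite gelfand_const !gelfandE ge_max lerNl andbC -ler_norml => h3.
rewrite distrC -(subrKA (gv (u n) x)) [e]splitr.
exact: le_trans (ler_normD _ _) (lerD h2 h3).
Qed.

End Spectrum.

Lemma inj_surj_cancel (T U : Type) (f : T -> U) : injective f ->
  (forall y, exists x, f x = y) -> exists g : U -> T, cancel f g /\ cancel g f.
Proof.
by move=> fI /choice[g fg]; exists g; split=> // x; apply: fI; rewrite fg.
Qed.

(** * Every compact basic extension comes from its spectrum *)

Section EssentialSurjectivity.
Variables (R : realType) (alpha : basic_extension R).
Hypothesis compact_alpha : compact_extension alpha.

(** Arbitrary proofs, so that they can be instantiated with the projections of [svalP X] used by the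
    functor. *)
Variable cX : compact [set: spectrum alpha].
Variable hX : hausdorff_space (spectrum alpha).

Definition spectrum_rep_fun (a : ext_dom alpha) : cont_alg R cX :=
  exist _ _ (@gelfand_continuous R alpha a).

Definition spectrum_rep : balHom (ext_dom alpha) (cont_alg R cX).
Proof.
apply: (@mk_balHom _ _ _ spectrum_rep_fun) => [a b||a b|r a|a b];
  apply: fval_ext => x; rewrite ?fvalE.
- by rewrite -[LHS]/(fval (gelfand alpha (a - b)) x) rmorphB.
- by rewrite -[LHS]/(fval (gelfand alpha (1 : ext_dom alpha)) x) rmorph1.
- by rewrite -[LHS]/(fval (gelfand alpha (a * b)) x) rmorphM.
- by rewrite -[LHS]/(fval (gelfand alpha (r *: a)) x) balHom_scale.
- by rewrite -[LHS]/(fval (gelfand alpha (join a b)) x) balHom_join fval_join.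
Defined.

Lemma spectrum_rep_inj : injective spectrum_rep.
Proof.
move=> a b /(congr1 (fun k : cont_alg R cX => fval k)) ab.
by apply: gelfand_inj; apply: fval_ext => x; have := congr1 (fun k => k x) ab.
Qed.

Lemma spectrum_rep_surj (f : cont_alg R cX) : exists a, spectrum_rep a = f.
Proof.
have [a ah] := gelfand_surj compact_alpha (h := cont_incl R cX f)
  (@fval_continuous R _ cX f).
by exists a; apply: fval_ext => x; rewrite -[LHS]/(fval (gelfand alpha a) x) ah.
Qed.

(** Both representations are bijective; their inverses are again homomorphisms, and normality is
    automatic for bijections. The square of the inverses is checked after applying the injective
    [atom_rep]. *)
Lemma cont_extension_spectrum : exists
  (f : basic_hom (cont_extension R cX hX) alpha)
  (g : basic_hom alpha (cont_extension R cX hX)),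
  basic_comp g f = basic_id (cont_extension R cX hX) /\
  basic_comp f g = basic_id alpha.
Proof.
have [r [rK Kr]] := inj_surj_cancel spectrum_rep_inj spectrum_rep_surj.
have [s [sK Ks]] := inj_surj_cancel (@atom_rep_inj R _ (ext_basic alpha))
  (@atom_rep_surj R _ (ext_basic alpha)).
have gC : bal_comp (atom_rep (ext_basic alpha)) alpha =
    bal_comp (cont_extension R cX hX) spectrum_rep.
  by apply: balHom_ext => a; apply: fval_ext.
pose g : basic_hom alpha (cont_extension R cX hX) :=
  @BasicHom R alpha (cont_extension R cX hX) spectrum_rep
    (atom_rep (ext_basic alpha)) (balHom_bij_normal sK Ks) gC.
have fC : bal_comp (balHom_inv sK Ks) (cont_extension R cX hX) =
    bal_comp alpha (balHom_inv rK Kr).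
  apply: balHom_ext => f; apply: (@atom_rep_inj R _ (ext_basic alpha)).
  have gCf := congr1 (fun k : balHom (ext_dom alpha)
    (linfty R (spectrum alpha)) => k (r f)) gC.
  apply: (etrans (Ks (cont_incl R cX f))); apply: (etrans _ (esym gCf)).
  by rewrite -[in LHS](Kr f).
exists (@BasicHom R (cont_extension R cX hX) alpha (balHom_inv rK Kr)
  (balHom_inv sK Ks)
  (@balHom_bij_normal _ _ _ (balHom_inv sK Ks) _ Ks sK) fC), g.
split; apply: basic_hom_ext; apply: balHom_ext => f.
- exact: Kr.
- exact: Ks.
- exact: rK.
- exact: sK.
Qed.

End EssentialSurjectivity.

Theorem theorem4p5 (R : realType) : dually_equivalent (cbasic R) KHaus.
Proof.
apply: (@fully_faithful_equivalent _ _ (cont_functor R)).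
- exact: cont_functor_faithful.
- exact: cont_functor_full.
move=> [alpha compact_alpha].
pose X : op_category KHaus := exist _ (spectrum alpha : topologicalType)
  (conj (spectrum_compact compact_alpha) (@spectrum_hausdorff R alpha)).
exists X; have [f [g gf]] := @cont_extension_spectrum R alpha compact_alpha
  (svalP X).1 (svalP X).2.
by exists f, g.
Qed.
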